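(* Let $n\geq 3$ and let $A_1,\ldots,A_n$ be positive definite matrices on a $d$-dimensional Hilbert space $\mathcal{H}$ with fixed orthonormal basis $\{|l\rangle\}_{l=1}^d$. Set $n':=\lceil \log_2(n-2)\rceil$ and $\rho:=2^{n'}-(n-2)$. Then $$ \operatorname{Tr}_{\mathcal{H}}\Big[\exp\Big(\sum_{k=1}^n \log A_k\Big)\Big] \leq \operatorname{Tr}_{\mathcal{H}^{\otimes 2^{n'}}}\Big[P_{2^{n'-1}}\, T_{\mathcal{A}}\Big(A_1\otimes \overline{A_n}\otimes \bigotimes_{j=0}^{n'-2} P_{2^j}\Big)\Big], $$ where $\mathcal{A}:=\Big(\bigotimes_{k=2}^{n-1} C^{\alpha_k}A_k^{-1}C^{\alpha_k}\Big)\otimes I_{\mathcal{H}}^{\otimes\rho}$ is a positive definite matrix on $\mathcal{H}^{\otimes 2^{n'}}$ (the tensor factors of $\mathcal{A}$ and of the argument of $T_{\mathcal{A}}$ are both identified with $\mathcal{H}^{\otimes 2^{n'}}$ in the order written), and the empty tensor product (when $n'=1$) is omitted.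
   Context: For $x\in\mathbb{R}$, $\lceil x\rceil$ denotes the smallest positive integer greater than or equal to $x$; in particular $\lceil 0\rceil=1$. The Thue–Morse sequence $\{\alpha_k\}_{k\geq 2}$ is defined by $\alpha_{j+2}:=\beta_j$ for $j\geq 0$, where $\beta_0=0$, $\beta_{2j}=\beta_j$, $\beta_{2j+1}=1-\beta_j$ (so $(\alpha_2,\alpha_3,\alpha_4,\alpha_5)=(0,1,1,0)$). For a matrix $X$ on $\mathcal{H}$, $\overline{X}$ denotes its entrywise complex conjugate in the fixed basis $\{|l\rangle\}$, and $C^{\alpha}XC^{\alpha}$ means $X$ if $\alpha=0$ and $\overline{X}$ if $\alpha=1$. For $m\geq1$, $|\Omega_m\rangle:=\sum_{l_1,\ldots,l_m=1}^d |l_1\otimes\cdots\otimes l_m\rangle\otimes|l_1\otimes\cdots\otimes l_m\rangle\in \mathcal{H}^{\otimes m}\otimes\mathcal{H}^{\otimes m}$ (not normalized), and $P_m:=|\Omega_m\rangle\langle\Omega_m|$, an operator on $\mathcal{H}^{\otimes 2m}$. For positive definite $X$ and any matrix $Y$ of the same size, $T_X(Y):=\frac{d}{dr}\big|_{r=0}\log(X+rY)=\int_0^\infty (X+\tau)^{-1}Y(X+\tau)^{-1}\,d\tau$, where $\tau$ stands for $\tau$ times the identity. *)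

(* Defs.v *)
From Stdlib Require Import Reals Lra Lia Arith List ClassicalEpsilon.
Open Scope R_scope.

Record C : Type := mkC { re : R; im : R }.
Definition C0 : C := mkC 0 0.
Definition C1 : C := mkC 1 0.
Definition RtoC (r : R) : C := mkC r 0.
Definition Cadd (x y : C) : C := mkC (re x + re y) (im x + im y).
Definition Copp (x : C) : C := mkC (- re x) (- im x).
Definition Cmul (x y : C) : C :=
  mkC (re x * re y - im x * im y) (re x * im y + im x * re y).
Definition Cconj (x : C) : C := mkC (re x) (- im x).

Fixpoint Csum (n : nat) (f : nat -> C) : C :=
  match n with O => C0 | S m => Cadd (Csum m f) (f m) end.

Definition Cle (x y : C) : Prop := im x = 0 /\ im y = 0 /\ re x <= re y.

(** * Matrices: an N x N matrix is a function on indices 0..N-1 *)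
Definition Mat := nat -> nat -> C.
Definition inhMat : inhabited Mat := inhabits (fun _ _ => C0).

Definition meq (N : nat) (X Y : Mat) : Prop :=
  forall i j, (i < N)%nat -> (j < N)%nat -> X i j = Y i j.
Definition mI : Mat := fun i j => if Nat.eqb i j then C1 else C0.
Definition mzero : Mat := fun _ _ => C0.
Definition madd (X Y : Mat) : Mat := fun i j => Cadd (X i j) (Y i j).
Definition mscale (r : R) (X : Mat) : Mat := fun i j => Cmul (RtoC r) (X i j).
Definition mmul (N : nat) (X Y : Mat) : Mat :=
  fun i j => Csum N (fun k => Cmul (X i k) (Y k j)).
Fixpoint mpow (N : nat) (X : Mat) (k : nat) : Mat :=
  match k with O => mI | S k' => mmul N X (mpow N X k') end.
Definition trace (N : nat) (X : Mat) : C := Csum N (fun i => X i i).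
Definition mconj (X : Mat) : Mat := fun i j => Cconj (X i j).
Definition conjif (a : bool) (X : Mat) : Mat := if a then mconj X else X.

Definition hermitian (N : nat) (X : Mat) : Prop :=
  forall i j, (i < N)%nat -> (j < N)%nat -> X i j = Cconj (X j i).
Definition posdef (N : nat) (X : Mat) : Prop :=
  hermitian N X /\
  forall v : nat -> C, (exists i, (i < N)%nat /\ v i <> C0) ->
    0 < re (Csum N (fun i => Csum N (fun j =>
              Cmul (Cconj (v i)) (Cmul (X i j) (v j))))).

Definition minv (N : nat) (X : Mat) : Mat :=
  epsilon inhMat (fun Y => meq N (mmul N X Y) mI).

Fixpoint exp_psum (N : nat) (X : Mat) (K : nat) : Mat :=
  match K with
  | O => mI
  | S K' => madd (exp_psum N X K') (mscale (/ INR (fact K)) (mpow N X K))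
  end.
Definition mexp (N : nat) (X : Mat) : Mat :=
  epsilon inhMat (fun E => forall i j, (i < N)%nat -> (j < N)%nat ->
    Un_cv (fun K => re (exp_psum N X K i j)) (re (E i j)) /\
    Un_cv (fun K => im (exp_psum N X K i j)) (im (E i j))).

(** Matrix logarithm of a positive definite matrix: the (unique) hermitian L
    with exp L = A. *)
Definition mlog (N : nat) (A : Mat) : Mat :=
  epsilon inhMat (fun L => hermitian N L /\ meq N (mexp N L) A).

Definition mT (N : nat) (X Y : Mat) : Mat :=
  epsilon inhMat (fun D => forall i j, (i < N)%nat -> (j < N)%nat ->
    derivable_pt_lim (fun r => re (mlog N (madd X (mscale r Y)) i j)) 0 (re (D i j)) /\
    derivable_pt_lim (fun r => im (mlog N (madd X (mscale r Y)) i j)) 0 (im (D i j))).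

Definition kron (b : nat) (A B : Mat) : Mat :=
  fun i j => Cmul (A (i / b)%nat (j / b)%nat) (B (i mod b)%nat (j mod b)%nat).
Fixpoint kronl (l : list (nat * Mat)) : nat * Mat :=
  match l with
  | nil => (1%nat, mI)
  | (a, A) :: l' => let (b, B) := kronl l' in ((a * b)%nat, kron b A B)
  end.

(** P_m = |Omega_m><Omega_m| on H^{(x)2m}, d = dim H.
    |Omega_m> = sum_{x < d^m} |x> (x) |x>, i.e. nonzero exactly at indices x*d^m + x. *)
Definition Pm (d m : nat) : Mat :=
  fun i j => let D := (d ^ m)%nat in
    if andb (Nat.eqb (i mod D) (i / D)) (Nat.eqb (j mod D) (j / D)) then C1 else C0.

(** * Thue–Morse sequence *)
Fixpoint bpar (fuel j : nat) : bool :=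
  match fuel with
  | O => false
  | S f => if Nat.eqb j 0 then false else xorb (Nat.odd j) (bpar f (Nat.div2 j))
  end.
Definition beta (j : nat) : bool := bpar j j.
Definition alpha (k : nat) : bool := beta (k - 2).

Example alpha_check : (alpha 2, alpha 3, alpha 4, alpha 5, alpha 6, alpha 9)
  = (false, true, true, false, true, true).
Proof. reflexivity. Qed.

(** n' = ceil(log2(n-2)) with the convention ceil 0 = 1 (smallest positive integer >= x) *)
Definition nprime (n : nat) : nat := Nat.max 1 (Nat.log2_up (n - 2)).
Definition rho (n : nat) : nat := (2 ^ nprime n - (n - 2))%nat.

Definition sum_logs (d n : nat) (A : nat -> Mat) : Mat :=
  fold_right (fun k M => madd (mlog d (A k)) M) mzero (seq 1 n).

Definition calA (d n : nat) (A : nat -> Mat) : Mat :=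
  snd (kronl (map (fun k => (d, conjif (alpha k) (minv d (A k)))) (seq 2 (n - 2))
              ++ repeat (d, mI) (rho n))).

Definition argT (d n : nat) (A : nat -> Mat) : Mat :=
  snd (kronl ((d, A 1%nat) :: (d, mconj (A n))
              :: map (fun j => ((d ^ (2 * 2 ^ j))%nat, Pm d (2 ^ j))) (seq 0 (nprime n - 1)))).

(* Main.v *)
Require Import Defs.
From Stdlib Require Import Reals Arith List.
From Stdlib Require Import ClassicalEpsilon.
From mathcomp Require all_boot all_order all_algebra spectral complex Rstruct.
From mathcomp Require ring lra.

(** Let [K(a,b) = (ln a - ln b) / (a - b)].  In an eigenbasis of [X], with
    eigenvalues [a_i], the matrix [T_X(Y)] has entries [K(a_i,a_j) Y_ij].

    Write [<Omega|W] as an operator: this contraction sends [X (x) Y] to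
    [Y^T X], and iterating it against the factors [P_{2^j}] of the argument
    turns the right-hand side into
    [sum_{p,q} K(alpha_p,alpha_q) Tr[X_p A_1 X_q^* A_n]], where [X_p] is the full
    contraction of the [p]-th spectral projection of the tensor product.  Since
    the Thue-Morse signs of [j] and [j + 2^m] are opposite for [j < 2^m], every
    transpose meets a complex conjugation, so [sum_p ln(alpha_p) X_p] is
    [- sum_{1<k<n} log A_k]; moreover
    [sum_{p,q} (alpha_p/alpha_q)^k X_p X_q^* = 1] for every natural [k], because the
    contraction of a tensor product is an ordered product of its factors.
    Interpolation replaces the [k]-th power by any function of the ratio.

    Inserting the spectral projections of [A_1] and [A_n] yields operators [P_j]
    with labels [a_j > 0] such that [sum_j P_j = 1], [sum_j ln(a_j) P_j = H] with
    [H = sum_k log A_k], and [sum_{i,j} phi(a_i/a_j) P_i P_j^* = phi(1)].  For those,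
    [Tr e^H <= sum_{i,j} a_i a_j K(a_i,a_j) Tr[P_i P_j^*]]: complete the family by
    minus the spectral projections of [e^H] and use that [K] is a positive
    semidefinite kernel while [(a + b) K(a,b)] is negative semidefinite on
    families of total weight zero. *)

Section TraceInequality.
Import all_boot all_order all_algebra spectral complex Rstruct.
Import mathcomp.algebra_tactics.ring mathcomp.algebra_tactics.lra.
Import Order.TTheory GRing.Theory Num.Theory.
Set Implicit Arguments.
Unset Strict Implicit.
Unset Printing Implicit Defensive.
Local Open Scope ring_scope.
Local Open Scope sesquilinear_scope.
Local Bind Scope ring_scope with Rdefinitions.R.
Local Arguments ln _%_ring_scope.
Local Arguments exp _%_ring_scope.
Notation R := Rdefinitions.R.
Notation K := R[i].
Local Notation "x %:C" := (real_complex R x) : ring_scope.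

(** * The kernel [logK] *)

(** The first divided difference of [ln], completed on the diagonal by the derivative [1/a]. For
    positive arguments it is the integral of [1/((a+t)(b+t))] over [t >= 0]; below, differentiation
    in a common shift [t] takes the place of this integral. *)
Definition logK (a b : R) : R :=
  if a == b then a^-1 else (ln a - ln b) / (a - b).

Lemma logKC a b : logK a b = logK b a.
Proof.
rewrite /logK eq_sym; case: eqVneq => [->//|nab].
by rewrite -(opprB a b) invrN mulrN -mulNr opprB.
Qed.

Lemma logK_sub a b : (a - b) * logK a b = ln a - ln b.
Proof.
rewrite /logK; case: eqVneq => [->|nab]; first by rewrite !subrr mul0r.
by rewrite mulrC divfK // subr_eq0.
Qed.

Lemma lnM (x y : R) : 0 < x -> 0 < y -> ln (x * y) = ln x + ln y.
Proof. by move=> /RltP x0 /RltP y0; exact: ln_mult. Qed.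

Lemma ln_sub1 (x : R) : 0 < x -> ln x <= x - 1.
Proof.
move=> x0; have := exp_ineq1_le (ln x); rewrite exp_ln; last exact/RltP.
by move=> /RleP; rewrite !RealsE => h; lra.
Qed.

Lemma lnV (x : R) : 0 < x -> ln x^-1 = - ln x.
Proof. by move=> /RltP x0; rewrite -RinvE ln_Rinv. Qed.

Lemma logKZ s a b : 0 < s -> 0 < a -> 0 < b -> logK (s * a) (s * b) = logK a b / s.
Proof.
move=> s0 a0 b0; rewrite /logK (inj_eq (mulfI (lt0r_neq0 s0))).
case: eqVneq => [->|nab]; first by rewrite invfM mulrC.
rewrite !lnM // -mulrBr opprD addrACA subrr add0r invfM; ring.
Qed.

Lemma logK_bound m a b : 0 < m -> m <= a -> m <= b -> 0 <= logK a b <= m^-1.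
Proof.
move=> m0; wlog ltba : a b / b <= a.
  move=> W ma mb; case: (leP b a) => h; first exact: W.
  by rewrite logKC; apply: W => //; apply: ltW.
move=> ma mb; have b0 := lt_le_trans m0 mb; have a0 := lt_le_trans m0 ma.
rewrite /logK; case: eqVneq => [_|nab].
  by rewrite invr_ge0 (ltW a0) /= lef_pV2.
have ab : 0 < a - b by rewrite subr_gt0 lt_neqAle eq_sym nab.
apply/andP; split.
  apply: divr_ge0; last exact: ltW.
  rewrite subr_ge0; apply/ltW/RltP; apply: ln_increasing; apply/RltP => //.
  by rewrite -subr_gt0.
(* With [b <= a], the bound [ln (a/b) <= a/b - 1] shows that the quotient is at most [1/b], hence at
   most [1/m]. *)
rewrite ler_pdivrMr // -lnV // -lnM ?invr_gt0 //.
apply: (le_trans (ln_sub1 _)); first by rewrite mulr_gt0 ?invr_gt0.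
have -> : a / b - 1 = b^-1 * (a - b) by field; rewrite lt0r_neq0.
by rewrite ler_wpM2r ?(ltW ab) // lef_pV2.
Qed.

(** A common shift leaves [a - b] unchanged, so off the diagonal only the numerator varies; on the
    diagonal the function is [1/(a+u)]. *)
Lemma logK_derive a b t : 0 < a + t -> 0 < b + t ->
  derivable_pt_lim (fun u => logK (a + u) (b + u)) t (- ((a + t)^-1 * (b + t)^-1)).
Proof.
move=> a0 b0.
have dl c : 0 < c + t -> derivable_pt_lim (fun u => ln (c + u)) t (c + t)^-1.
  move=> c0; have -> : (c + t)^-1 = Rmult (Rinv (Rplus c t)) (Rplus 0 1).
    by rewrite RinvE !RealsE add0r mulr1.
  apply: (derivable_pt_lim_comp (fun u => Rplus c u) ln).
    exact: (derivable_pt_lim_plus _ _ _ _ _ (derivable_pt_lim_const _ _) (derivable_pt_lim_id _)).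
  exact/derivable_pt_lim_ln/RltP.
case: (eqVneq a b) => [eab|nab].
  subst b; apply: (derivable_pt_lim_ext (div_fct (fun=> 1) (fun u => Rplus a u))).
    by move=> u; rewrite /logK eqxx /div_fct !RealsE div1r.
  have nz : a + t != 0 by rewrite lt0r_neq0.
  have -> : - ((a + t)^-1 * (a + t)^-1) =
      Rdiv (Rminus (Rmult 0 (Rplus a t)) (Rmult (Rplus 0 1) 1)) (Rsqr (Rplus a t)).
    by rewrite /Rsqr !RealsE add0r invfM; ring.
  apply: (derivable_pt_lim_div (fun=> 1) (fun u => Rplus a u)).
  - exact: derivable_pt_lim_const.
  - exact: (derivable_pt_lim_plus _ _ _ _ _ (derivable_pt_lim_const _ _) (derivable_pt_lim_id _)).
  - exact/eqP.
have nab' : a - b != 0 by rewrite subr_eq0.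
apply: (derivable_pt_lim_ext (fun u => Rmult (Rminus (ln (a + u)) (ln (b + u))) (a - b)^-1)).
  move=> u; rewrite /logK (inj_eq (addIr u)) (negPf nab) !RealsE.
  by rewrite [b + u]addrC opprD addrA addrK.
have -> : - ((a + t)^-1 * (b + t)^-1) =
   Rplus (Rmult (Rminus (a+t)^-1 (b+t)^-1) (a - b)^-1) (Rmult (Rminus (ln (a + t)) (ln (b + t))) 0).
  rewrite !RealsE mulr0 addr0; field.
  by rewrite (lt0r_neq0 a0) (lt0r_neq0 b0) nab'.
apply: (derivable_pt_lim_mult _ (fun=> (a-b)^-1)); last exact: derivable_pt_lim_const.
by apply: derivable_pt_lim_minus; apply: dl.
Qed.

Lemma derivable_pt_lim_bigsum (I : Type) (s : seq I) (f : I -> R -> R) (l : I -> R) x :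
  (forall i, derivable_pt_lim (f i) x (l i)) ->
  derivable_pt_lim (fun t => \sum_(i <- s) f i t) x (\sum_(i <- s) l i).
Proof.
move=> H; elim: s => [|i s IH].
  rewrite big_nil; apply: (derivable_pt_lim_ext (fun=> 0)).
    by move=> t; rewrite big_nil.
  exact: derivable_pt_lim_const.
rewrite big_cons; apply: (derivable_pt_lim_ext (fun t => Rplus (f i t) (\sum_(j <- s) f j t))).
  by move=> t; rewrite big_cons.
exact: derivable_pt_lim_plus.
Qed.

(** A negative value at 0 would persist by monotonicity, while the lower bound tends to 0 at
    infinity. This stands in for integrating [- f'] over the half-line. *)
Lemma nonincreasing_vanishing_ge0 (f f' : R -> R) (C : R) :
  (forall t, 0 <= t -> derivable_pt_lim f t (f' t)) -> (forall t, 0 <= t -> f' t <= 0) ->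
  (forall t, 0 < t -> - (C / t) <= f t) -> 0 <= f 0.
Proof.
move=> df sf lf; rewrite leNgt; apply/negP => f0.
(* Positive and strictly larger than [C]: at [T = C' / - f 0] the lower bound equals [f 0 * C / C'],
   which exceeds [f 0]. *)
pose C' := `|C| + 1.
have C'0 : 0 < C' by rewrite ltr_pwDr.
pose T := C' / - f 0.
have T0 : 0 < T by rewrite divr_gt0 // oppr_gt0.
have [c []] := MVT_cor2 f f' 0 T (elimT RltP T0) (fun c h => df c (introT RleP (proj1 h))).
rewrite !RealsE subr0 => E [/RltP c0 _].
have le1 : f T <= f 0.
  by rewrite -subr_le0 E mulr_le0_ge0 ?(ltW T0) // sf // ltW.
have := le_trans (lf _ T0) le1.
have -> : C / T = - (C * f 0 / C').
  by rewrite /T; field; rewrite (lt0r_neq0 C'0) ltr0_neq0.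
rewrite opprK leNgt => /negP; apply.
rewrite ltr_pdivlMr // mulrC -subr_gt0 -mulrBl.
by rewrite nmulr_rgt0 // subr_lt0 /C' (le_lt_trans (ler_norm C)) // ltrDl.
Qed.

(** * Quadratic forms of the kernel on finite families *)

Section Kernel.
Variables (J : finType) (a : J -> R).
Hypothesis a0 : forall j, 0 < a j.

Let aV (x : J -> R) (t : R) := \sum_j x j * (a j + t)^-1.

Let at0 j t : 0 <= t -> 0 < a j + t.
Proof. by move=> t0; rewrite ltr_pwDl. Qed.

Let form_derive (w : J -> J -> R) t : 0 <= t ->
  derivable_pt_lim (fun u => \sum_i \sum_j w i j * logK (a i + u) (a j + u)) t
    (- \sum_i \sum_j w i j * ((a i + t)^-1 * (a j + t)^-1)).
Proof.
move=> t0; rewrite -sumrN; apply: derivable_pt_lim_bigsum => i.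
rewrite -sumrN; apply: derivable_pt_lim_bigsum => j.
rewrite -mulrN; apply: (derivable_pt_lim_scal (fun u => logK (a i + u) (a j + u))).
by apply: logK_derive; apply: at0.
Qed.

Let form_bound (w : J -> J -> R) t : 0 < t ->
  - ((\sum_i \sum_j `|w i j|) / t) <=
     \sum_i \sum_j w i j * logK (a i + t) (a j + t).
Proof.
move=> t0; rewrite mulr_suml -sumrN; apply: ler_sum => i _.
rewrite mulr_suml -sumrN; apply: ler_sum => j _.
have h k : t <= a k + t by rewrite lerDr ltW.
have /andP[k0 k1] := logK_bound t0 (h i) (h j).
apply: (le_trans (y := - (`|w i j| * logK (a i + t) (a j + t)))).
  by rewrite lerN2 ler_wpM2l.
by rewrite -mulNr ler_wpM2r // lerNnormlW.
Qed.

(* The derivative of [logK (a + t) (b + t)] in [t] is minus the rank-one kernel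
   [1 / ((a + t) (b + t))], and [logK (a + t) (b + t)] vanishes at infinity. *)
Lemma logK_psd (x : J -> R) : 0 <= \sum_i \sum_j x i * x j * logK (a i) (a j).
Proof.
pose f (t : R) : R := \sum_i \sum_j x i * x j * logK (a i + t) (a j + t).
suff : 0 <= f 0.
  rewrite /f; congr (0 <= _); apply: eq_bigr => i _; apply: eq_bigr => j _.
  by rewrite !addr0.
apply: (nonincreasing_vanishing_ge0 (f := f)
  (fun t t0 => form_derive (fun i j => x i * x j) t0) _
  (form_bound (fun i j => x i * x j))) => t t0.
rewrite oppr_le0; suff -> : \sum_i \sum_j x i * x j * ((a i + t)^-1 * (a j + t)^-1) = aV x t ^+ 2.
  exact: sqr_ge0.
rewrite expr2 big_distrlr /=; apply: eq_bigr => i _; apply: eq_bigr => j _; ring.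
Qed.

(* Here [a + b = (a + t) + (b + t) - 2 t], and the first two terms drop out of the
   differentiated form because the weights sum to zero. *)
Lemma logK_cond_nsd (x : J -> R) : \sum_j x j = 0 ->
  \sum_i \sum_j x i * x j * ((a i + a j) * logK (a i) (a j)) <= 0.
Proof.
move=> x0; pose w i j := - (x i * x j * (a i + a j)).
pose f (t : R) : R := \sum_i \sum_j w i j * logK (a i + t) (a j + t).
rewrite -oppr_ge0; suff : 0 <= f 0.
  rewrite /f -sumrN; congr (0 <= _); apply: eq_bigr => i _.
  rewrite -sumrN; apply: eq_bigr => j _; rewrite !addr0 /w; ring.
apply: (nonincreasing_vanishing_ge0 (f := f)
  (fun t t0 => form_derive w t0) _ (form_bound w)) => t t0.
have -> : - (\sum_i \sum_j w i j * ((a i + t)^-1 * (a j + t)^-1)) = - (2 * t * aV x t ^+ 2).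
  transitivity (aV x t * \sum_j x j + (\sum_j x j) * aV x t - 2 * t * aV x t ^+ 2).
    rewrite expr2 !big_distrlr /= mulr_sumr -!sumrN -!big_split /=.
    apply: eq_bigr => i _; rewrite mulr_sumr -!sumrN -!big_split /=.
    apply: eq_bigr => j _; rewrite /w.
    have := lt0r_neq0 (at0 i t0); have := lt0r_neq0 (at0 j t0) => nj ni.
    by field; rewrite ni nj.
  by rewrite x0 mulr0 mul0r !add0r.
by rewrite oppr_le0 mulr_ge0 ?sqr_ge0 ?mulr_ge0.
Qed.
End Kernel.

Lemma big_option (V : nmodType) (J : finType) (F : option J -> V) :
  \sum_i F i = F None + \sum_j F (Some j).
Proof.
rewrite (bigD1 None) //=; congr (_ + _).
rewrite (reindex_omap Some id) /=; last by case.
by apply: eq_bigl => j; rewrite /= eqxx.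
Qed.

(* The row [x] of the identity plays the role of a unit vector: the family
   [z] is completed by the vector [- e_x] labelled by [b = exp h], which makes
   its sum vanish. *)
Lemma exp_le_logK_form (J Y : finType) (a : J -> R) (z : J -> Y -> R) (x : Y) (h : R) :
  (forall j, 0 < a j) ->
  (forall y, \sum_j z j y = (y == x)%:R) ->
  \sum_j z j x * ln (a j) = h ->
  \sum_y \sum_i \sum_j z i y * z j y * ((a i + a j) * logK (a i) (a j)) = 2 ->
  exp h <= \sum_y \sum_i \sum_j (a i * z i y) * (a j * z j y) * logK (a i) (a j).
Proof.
move=> a0 z1 zh zU; pose b := exp h.
have b0 : 0 < b by apply/RltP; exact: exp_pos.
pose a' (o : option J) := if o is Some j then a j else b.
have a'0 o : 0 < a' o by case: o.
have Kbb : logK b b = b^-1 by rewrite /logK eqxx.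
pose s1 := \sum_j z j x * (a j * logK (a j) b).
pose s2 := \sum_j z j x * ((a j + b) * logK (a j) b).
have expand (k : R -> R -> R) (w : option J -> R) : (forall u v, k u v = k v u) ->
    \sum_i \sum_j w i * w j * k (a' i) (a' j) =
    \sum_i \sum_j w (Some i) * w (Some j) * k (a i) (a j)
     + 2 * (w None * \sum_j w (Some j) * k (a j) b) + w None ^+ 2 * k b b.
  move=> kC; rewrite big_option big_option /=.
  under [X in _ + X = _]eq_bigr do rewrite big_option /=.
  have -> : \sum_j w None * w (Some j) * k b (a j) = w None * \sum_j w (Some j) * k (a j) b.
    by rewrite mulr_sumr; apply: eq_bigr => j _; rewrite kC mulrA.
  rewrite big_split /=.
  have -> : \sum_j w (Some j) * w None * k (a j) b = w None * \sum_j w (Some j) * k (a j) b.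
    by rewrite mulr_sumr; apply: eq_bigr => j _; rewrite mulrCA !mulrA.
  ring.
have sum_delta (F : Y -> R) : \sum_y (y == x)%:R * F y = F x.
  by rewrite (bigD1 x) //= eqxx mul1r big1 ?addr0 // => y /negPf->; rewrite mul0r.
have sum_cross (F : Y -> R) (c : R) : \sum_y 2 * (- (c * (y == x)%:R) * F y) = - 2 * (c * F x).
  by rewrite -sum_delta !mulr_sumr; apply: eq_bigr => y _; ring.
have sum_diag (k c : R) : \sum_y (- (c * (y == x)%:R)) ^+ 2 * k = c ^+ 2 * k.
  rewrite -(sum_delta (fun=> c ^+ 2 * k)); apply: eq_bigr => y _.
  by case: (y == x); rewrite /= ?mulr1 ?mulr0 ?oppr0 ?sqrrN ?expr0n ?mul0r ?mul1r.
(* Since [(a + b) - 2 a = - (a - b)], the difference [s2 - 2 s1] is minus the sum of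
   [z j x * (ln (a j) - ln b)], and this is [h - h]. *)
have E12 : s2 = 2 * s1.
  suff : s2 - 2 * s1 = 0 by move/eqP; rewrite subr_eq0 => /eqP.
  transitivity (- (\sum_j z j x * ln (a j) - (\sum_j z j x) * h)); last first.
    by rewrite zh z1 eqxx mul1r subrr oppr0.
  rewrite /s1 /s2 mulr_sumr mulr_suml -!sumrB -sumrN; apply: eq_bigr => j _.
  have -> : h = ln b by rewrite /b ln_exp.
  have := logK_sub (a j) b => E.
  rewrite -mulrBr -E; ring.
(* Conditional negativity for the completed family reads [2 - 2 s2 + 2 <= 0]. *)
have B2 : 2 <= s2.
  pose w y (o : option J) := if o is Some j then z j y else - (1 * (y == x)%:R).
  have : \sum_y \sum_i \sum_j w y i * w y j * ((a' i + a' j) * logK (a' i) (a' j)) <= 0.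
    apply: sumr_le0 => y _; apply: (logK_cond_nsd a'0).
    by rewrite big_option /= z1 mul1r addNr.
  have kC u v : (u + v) * logK u v = (v + u) * logK v u by rewrite addrC logKC.
  under eq_bigr do rewrite (expand (fun u v => (u + v) * logK u v) _ kC) /=.
  rewrite !big_split /= zU (sum_cross (fun y => \sum_j z j y * ((a j + b) * logK (a j) b)) 1).
  rewrite (sum_diag _ 1) -/s2 Kbb (_ : (b + b) / b = 2); last first.
    by field; rewrite lt0r_neq0.
  by move=> H; lra.
(* Positivity for the family weighted by its labels reads [0 <= S - 2 b s1 + b], where [S] is the
   right-hand side of the claim. With [s1 >= 1] this gives [S >= b]. *)
pose w y (o : option J) := if o is Some j then a j * z j y else - (b * (y == x)%:R).
have : 0 <= \sum_y \sum_i \sum_j w y i * w y j * logK (a' i) (a' j).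
  by apply: sumr_ge0 => y _; apply: (logK_psd a'0).
under eq_bigr do rewrite (expand logK _ logKC) /=.
rewrite !big_split /= (sum_cross (fun y => \sum_j a j * z j y * logK (a j) b) b) (sum_diag _ b).
rewrite (_ : \sum_j a j * z j x * logK (a j) b = s1); last first.
  by apply: eq_bigr => j _; rewrite mulrCA mulrA.
rewrite Kbb (_ : b ^+ 2 / b = b); last by field; rewrite lt0r_neq0.
move=> H; have : b * 1 <= b * s1 by rewrite ler_wpM2l ?(ltW b0) //; lra.
by rewrite -/b; lra.
Qed.

(** * Spectral calculus *)

(** For unitary [U], the hermitian matrix with eigenvalues [h] and the columns of [U] as eigenbasis.
    Matrix functions then act on [h] alone. *)
Definition spectral_mx N (U : 'M[K]_N) (h : 'I_N -> R) : 'M[K]_N :=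
  U *m diag_mx (\row_i (h i)%:C) *m U^t*.

(** The imaginary part of [u i * (u j)^*] is antisymmetric in [i, j], so a symmetric real kernel
    annihilates it. *)
Lemma real_form (J : finType) (k : J -> J -> R) (u : J -> K) :
  (forall i j, k i j = k j i) ->
  \sum_i \sum_j (k i j)%:C * (u i * (u j)^*) =
  (\sum_i \sum_j (complex.Re (u i) * complex.Re (u j) + complex.Im (u i) * complex.Im (u j)) * k i j)%:C.
Proof.
move=> kC; pose s i j := (complex.Im (u i) * complex.Re (u j) - complex.Re (u i) * complex.Im (u j)) * k i j.
have s0 : \sum_i \sum_j s i j = 0.
  suff : \sum_i \sum_j s i j = - \sum_i \sum_j s i j by move=> ?; lra.
  rewrite {1}exchange_big /= -sumrN; apply: eq_bigr => i _; rewrite -sumrN.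
  by apply: eq_bigr => j _; rewrite /s kC; ring.
have E i j : (k i j)%:C * (u i * (u j)^*) =
    Complex ((complex.Re (u i) * complex.Re (u j) + complex.Im (u i) * complex.Im (u j)) * k i j) (s i j).
  rewrite /s; case: (u i) (u j) => [x y] [x' y'].
  by apply/eqP; rewrite eq_complex /=; apply/andP; split; apply/eqP; ring.
apply/eqP; rewrite eq_complex; apply/andP; split; apply/eqP.
  rewrite [LHS]raddf_sum; apply: eq_bigr => i _; rewrite [LHS]raddf_sum.
  by apply: eq_bigr => j _; rewrite E.
rewrite [RHS]/= -s0 [LHS]raddf_sum; apply: eq_bigr => i _; rewrite [LHS]raddf_sum.
by apply: eq_bigr => j _; rewrite E.
Qed.

(** In the basis [V], the [x]-th rows of the matrices [V^* P_j V] sum to the basis vector [e_x], and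
    their [ln]-weighted sum has [x]-th coordinate [h x]. The inequality for vectors is applied to
    every row, and summation over [x] produces the traces. *)
Lemma trace_exp_le_logK_form d (J : finType) (a : J -> R) (P : J -> 'M[K]_d)
    (V : 'M[K]_d) (h : 'I_d -> R) :
  (forall j, 0 < a j) -> V \is unitarymx ->
  \sum_j P j = 1%:M ->
  \sum_j (ln (a j))%:C *: P j = spectral_mx V h ->
  (forall phi : R -> R,
     \sum_i \sum_j (phi (a i / a j))%:C *: (P i *m (P j)^t*) = ((phi 1)%:C)%:M) ->
  \sum_x (exp (h x))%:C <=
  \sum_i \sum_j (a i * a j * logK (a i) (a j))%:C * \tr (P i *m (P j)^t*).
Proof.
move=> a0 uV P1 Ph PU; pose Q j := V^t* *m P j *m V.
have VV : V *m V^t* = 1%:M by apply/unitarymxP.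
have VV' : V^t* *m V = 1%:M by apply: mulmx1C.
have QQ i j : Q i *m (Q j)^t* = V^t* *m (P i *m (P j)^t*) *m V.
  rewrite /Q !trmx_mul !map_mxM trmxCK.
  by rewrite !mulmxA -[V^t* *m P i *m V *m V^t*]mulmxA VV mulmx1.
(* Each complex entry counts as two real coordinates, the flag [false] marking the real part. *)
pose Y : finType := ('I_d * bool)%type.
pose c (u : K) (b : bool) := if b then complex.Im u else complex.Re u.
pose z x j (y : Y) := c (Q j x y.1) y.2.
have formE (k : J -> J -> R) x : (forall i j, k i j = k j i) ->
    \sum_i \sum_j (k i j)%:C * (Q i *m (Q j)^t*) x x =
    (\sum_y \sum_i \sum_j z x i y * z x j y * k i j)%:C.
  move=> kC; transitivity (\sum_y \sum_i \sum_j (k i j)%:C * (Q i x y * (Q j x y)^*)).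
    rewrite [RHS]exchange_big; apply: eq_bigr => i _; rewrite [RHS]exchange_big.
    apply: eq_bigr => j _; rewrite mxE mulr_sumr; apply: eq_bigr => y _.
    by rewrite !mxE.
  rewrite (eq_bigr _ (fun y _ => real_form _ kC)) -rmorph_sum; congr (real_complex R _).
  rewrite -(pair_bigA _ (fun y b => \sum_i \sum_j z x i (y,b) * z x j (y,b) * k i j)) /=.
  apply: eq_bigr => y _; rewrite big_bool -big_split; apply: eq_bigr => i _.
  rewrite -big_split; apply: eq_bigr => j _; rewrite /z /= mulrDl; exact: addrC.
have trQ i j : \tr (P i *m (P j)^t*) = \sum_x (Q i *m (Q j)^t*) x x.
  by rewrite QQ -/(\tr _) [RHS]mxtrace_mulC mulmxA VV mul1mx.
have kC i j : a i * a j * logK (a i) (a j) = a j * a i * logK (a j) (a i).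
  by rewrite logKC; ring.
apply: (le_trans (y := \sum_x \sum_i \sum_j (a i * a j * logK (a i) (a j))%:C * (Q i *m (Q j)^t*) x x)); last first.
  rewrite exchange_big le_eqVlt; apply/orP; left; apply/eqP; apply: eq_bigr => i _.
  rewrite exchange_big; apply: eq_bigr => j _.
  by rewrite trQ mulr_sumr.
apply: ler_sum => x _; rewrite formE // lecR.
have -> : \sum_y \sum_i \sum_j z x i y * z x j y * (a i * a j * logK (a i) (a j)) =
  \sum_y \sum_i \sum_j (a i * z x i y) * (a j * z x j y) * logK (a i) (a j).
  apply: eq_bigr => y _; apply: eq_bigr => i _; apply: eq_bigr => j _.
  by move: (z x i y) (z x j y) (logK _ _) => u v k; ring.
have sumQ (f : J -> R) M : \sum_j (f j)%:C *: P j = M -> forall y b,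
    \sum_j f j * c (Q j x y) b = c ((V^t* *m M *m V) x y) b.
  move=> <- y b; rewrite mulmx_sumr mulmx_suml.
  rewrite summxE.
  have cS (F : J -> K) : c (\sum_j F j) b = \sum_j c (F j) b.
    by case: b; rewrite /c raddf_sum.
  rewrite cS; apply: eq_bigr => j _; rewrite -scalemxAr -scalemxAl [in RHS]mxE -/(Q j).
  by clear cS; case: b; rewrite /c; case: (Q j x y) => s t /=; ring.
apply: (exp_le_logK_form (x := (x, false))) => //.
- case=> y b; have := sumQ (fun=> 1) 1%:M; rewrite mulmx1 VV' => E.
  rewrite /z /=; transitivity (c ((1%:M : 'M[K]_d) x y) b).
    rewrite -E; first by apply: eq_bigr => j _; rewrite mul1r.
    by rewrite -P1; apply: eq_bigr => j _; rewrite scale1r.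
  rewrite mxE xpair_eqE [y == x]eq_sym /c.
  by case: b; case: (x == y).
- transitivity (\sum_j ln (a j) * c (Q j x x) false).
    by apply: eq_bigr => j _; rewrite mulrC.
  rewrite (sumQ _ _ Ph) /spectral_mx /= !mulmxA VV' mul1mx -mulmxA VV' mulmx1.
  by rewrite !mxE eqxx.
(* By homogeneity [(a + b) * logK a b] depends on [a / b] only, so the hypothesis on functions of
   the ratio applies; its value is [phi 1 = 2]. *)
- pose phi t := (t + 1) * logK t 1.
  have phiE i j : (a i + a j) * logK (a i) (a j) = phi (a i / a j).
    have aj0 := lt0r_neq0 (a0 j); rewrite /phi.
    have -> : logK (a i) (a j) = logK (a j * (a i / a j)) (a j * 1).
      by rewrite mulr1 mulrCA divff // mulr1.
    by rewrite logKZ ?divr_gt0 //; field.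
  apply: complexI; rewrite -formE; last by move=> i j; rewrite addrC logKC.
  transitivity ((V^t* *m (\sum_i \sum_j (phi (a i / a j))%:C *: (P i *m (P j)^t*)) *m V) x x).
    rewrite mulmx_sumr mulmx_suml summxE; apply: eq_bigr => i _.
    rewrite mulmx_sumr mulmx_suml summxE; apply: eq_bigr => j _.
    by rewrite phiE QQ -scalemxAr -scalemxAl [in RHS]mxE.
  rewrite PU scalar_mxC -mulmxA VV' mulmx1 !mxE eqxx mulr1n /phi /logK eqxx.
  by rewrite invr1 mulr1.
Qed.

Section Spectral.
Variable N : nat.
Implicit Types (U V : 'M[K]_N) (f g h : 'I_N -> R).

Lemma unitary_mulVmx U : U \is unitarymx -> U^t* *m U = 1%:M.
Proof. by move=> /unitarymxP; exact: mulmx1C. Qed.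

Lemma unitary_adj U : U \is unitarymx -> U^t* \is unitarymx.
Proof. by move=> uU; apply/unitarymxP; rewrite trmxCK; exact: unitary_mulVmx. Qed.

Lemma unitary_conj U : U \is unitarymx -> map_mx Num.Def.conjC U \is unitarymx.
Proof.
move=> /unitarymxP uU; apply/unitarymxP.
by rewrite -(map_mx1 Num.Def.conjC) -uU map_mxM map_trmx.
Qed.

Lemma spectral_mxM U f g : U \is unitarymx -> spectral_mx U f *m spectral_mx U g = spectral_mx U (fun i => f i * g i).
Proof.
move=> uU; rewrite /spectral_mx !mulmxA -[_ *m U^t* *m U]mulmxA unitary_mulVmx // mulmx1.
rewrite -[_ *m diag_mx _ *m diag_mx _]mulmxA mulmx_diag; congr (_ *m diag_mx _ *m _).
by apply/rowP => i; rewrite !mxE rmorphM.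
Qed.

Lemma spectral_mx1 U : U \is unitarymx -> spectral_mx U (fun=> 1) = 1%:M.
Proof.
move=> /unitarymxP uU; rewrite /spectral_mx (_ : \row__ _ = const_mx 1).
  by rewrite diag_const_mx mulmx1.
by apply/rowP => i; rewrite !mxE.
Qed.

Lemma spectral_mxE U f i j : spectral_mx U f i j = \sum_k (f k)%:C * (U i k * (U j k)^*).
Proof.
rewrite /spectral_mx mxE; apply: eq_bigr => k _.
by rewrite mul_mx_diag !mxE -mulrA mulrCA.
Qed.

Lemma eq_spectral_mx U f g : f =1 g -> spectral_mx U f = spectral_mx U g.
Proof. by move=> E; apply/matrixP => i j; rewrite !spectral_mxE; apply: eq_bigr => k _; rewrite E. Qed.

Lemma spectral_mxD U f g : spectral_mx U f + spectral_mx U g = spectral_mx U (fun i => f i + g i).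
Proof.
apply/matrixP => i j; rewrite mxE !spectral_mxE -big_split; apply: eq_bigr => k _.
by rewrite rmorphD mulrDl.
Qed.

Lemma spectral_mxZ U c f : c%:C *: spectral_mx U f = spectral_mx U (fun i => c * f i).
Proof.
apply/matrixP => i j; rewrite mxE !spectral_mxE mulr_sumr; apply: eq_bigr => k _.
by rewrite rmorphM mulrA.
Qed.

Lemma spectral_mx_herm U f : (spectral_mx U f)^t* = spectral_mx U f.
Proof.
apply/matrixP => i j; rewrite 2!mxE !spectral_mxE rmorph_sum; apply: eq_bigr => k _ /=.
rewrite !rmorphM /= conjCK; congr (_ * _); last exact: mulrC.
by apply/CrealP; rewrite complex_real.
Qed.

Lemma hermitian_spectral_mx (A : 'M[K]_N) : A^t* = A -> exists U f, U \is unitarymx /\ A = spectral_mx U f.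
Proof.
move=> hA; have hA' : A \is hermsymmx.
  by apply/is_hermitianmxP; rewrite expr0 scale1r hA.
have := hermitian_normalmx hA' => /orthomx_spectralP E.
exists ((spectralmx A)^t*), (fun i => complex.Re (spectral_diag A 0 i)).
split; first by rewrite trmxC_unitary spectral_unitarymx.
rewrite {1}E /spectral_mx trmxCK (invmx_unitary (spectral_unitarymx _)).
congr (_ *m diag_mx _ *m _); apply/rowP => i; rewrite !mxE RRe_real //.
by move/mxOverP: (hermitian_spectral_diag_real hA') => /(_ 0 i).
Qed.

(** Read between two eigenbases, a difference of spectral matrices multiplies each entry of the
    overlap [U^* V] by a difference of eigenvalues. Both the uniqueness of the functional calculus
    and the perturbation estimates rest on this. *)
Lemma spectral_mx_sub U V f g i j : U \is unitarymx -> V \is unitarymx ->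
  (U^t* *m (spectral_mx U f - spectral_mx V g) *m V) i j = (f i - g j)%:C * (U^t* *m V) i j.
Proof.
move=> uU uV; rewrite mulmxBr mulmxBl /spectral_mx !mulmxA unitary_mulVmx // mul1mx.
rewrite -[_ *m V^t* *m V]mulmxA unitary_mulVmx // mulmx1.
rewrite -[_ *m U^t* *m V]mulmxA mxE.
move: (U^t* *m V) => W; rewrite mul_diag_mx mul_mx_diag !mxE rmorphB /= mulrBl.
by rewrite [W i j * _]mulrC.
Qed.

(** The functional calculus does not depend on the diagonalization: a nonzero overlap entry forces
    equal eigenvalues, hence equal values of [F]. *)
Lemma spectral_mx_functional U V f g (F : R -> R) : U \is unitarymx -> V \is unitarymx ->
  spectral_mx U f = spectral_mx V g -> spectral_mx U (F \o f) = spectral_mx V (F \o g).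
Proof.
move=> uU uV E; apply/eqP; rewrite -subr_eq0; apply/eqP.
set D := _ - _; suff D0 : U^t* *m D *m V = 0.
  rewrite -[D]mul1mx -(unitarymxP uU) -[_ *m D]mulmx1 -(unitarymxP uV).
  by rewrite !mulmxA -2![U *m _ *m _]mulmxA D0 mulmx0 mul0mx.
apply/matrixP => i j; rewrite spectral_mx_sub // [RHS]mxE /=.
case: (eqVneq (f i) (g j)) => [->|nfg]; first by rewrite subrr rmorph0 mul0r.
have := spectral_mx_sub f g i j uU uV; rewrite E subrr mulmx0 mul0mx [LHS]mxE => /esym/eqP.
rewrite mulf_eq0 => /orP[|/eqP->]; last by rewrite mulr0.
by rewrite eq_complex /= subr_eq0 (negPf nfg).
Qed.

Lemma unitary_entry_le1 U i j : U \is unitarymx -> `|U i j| <= 1.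
Proof.
move=> /unitarymxP /matrixP /(_ i i); rewrite !mxE eqxx => E.
rewrite -(@expr_le1 _ 2) // -[X in _ <= X]E (bigD1 j) //= !mxE normCK lerDl.
by apply: sumr_ge0 => k _; rewrite !mxE mul_conjC_ge0.
Qed.
End Spectral.

(** * Matrix functions *)

Definition toC (x : Defs.C) : K := Complex (Defs.re x) (Defs.im x).
Definition toM N (X : Mat) : 'M[K]_N := \matrix_(i, j) toC (X i j).

Lemma toC_inj : injective toC.
Proof. by case=> a b [c d] [-> ->]. Qed.
Lemma toC_mul x y : toC (Cmul x y) = toC x * toC y. Proof. by []. Qed.
Lemma toC_conj x : toC (Cconj x) = (toC x)^*. Proof. by []. Qed.
Lemma toC_sum n f : toC (Csum n f) = \sum_(i < n) toC (f i).
Proof. by elim: n => [|n IH]; rewrite ?big_ord0 // big_ord_recr /= -IH. Qed.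

Lemma meqP N X Y : meq N X Y <-> toM N X = toM N Y.
Proof.
split=> [H|/matrixP H i j /ssrnat.ltP hi /ssrnat.ltP hj].
  by apply/matrixP => i j; rewrite !mxE H //; apply/ssrnat.ltP; exact: ltn_ord.
by have := H (Ordinal hi) (Ordinal hj); rewrite !mxE => /toC_inj.
Qed.

Lemma toM_mul N X Y : toM N (mmul N X Y) = toM N X *m toM N Y.
Proof. by apply/matrixP => i j; rewrite !mxE toC_sum; apply: eq_bigr => k _; rewrite !mxE toC_mul. Qed.
Lemma toM_I N : toM N mI = 1%:M.
Proof.
apply/matrixP => i j; rewrite !mxE /mI -val_eqE /=.
by case: (Nat.eqb_spec i j) => [/eqP|/eqP/negPf] ->.
Qed.
Lemma toM_add N X Y : toM N (madd X Y) = toM N X + toM N Y.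
Proof. by apply/matrixP => i j; rewrite !mxE. Qed.
Lemma toM_scale N r X : toM N (mscale r X) = r%:C *: toM N X.
Proof. by apply/matrixP => i j; rewrite !mxE. Qed.
Lemma toM_conj N X : toM N (mconj X) = map_mx Num.Def.conjC (toM N X).
Proof. by apply/matrixP => i j; rewrite !mxE. Qed.
Lemma toM_trace N X : toC (trace N X) = \tr (toM N X).
Proof. by rewrite toC_sum; apply: eq_bigr => i _; rewrite mxE. Qed.
Lemma toM_herm N X : Defs.hermitian N X <-> (toM N X)^t* = toM N X.
Proof.
split=> [H|/matrixP H i j /ssrnat.ltP hi /ssrnat.ltP hj].
  by apply/matrixP => i j; rewrite !mxE H ?toC_conj ?conjCK //; apply/ssrnat.ltP; exact: ltn_ord.
by have := H (Ordinal hi) (Ordinal hj); rewrite !mxE -toC_conj => /toC_inj.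
Qed.

(** A right inverse of [toM]. It supplies the existence witnesses from which the matrices chosen by
    [epsilon] obtain their specification. *)
Definition ofM N (A : 'M[K]_N) : Mat := fun i j =>
  if (insub i, insub j) is (Some i', Some j') then
    mkC (complex.Re (A i' j')) (complex.Im (A i' j')) else C0.
Lemma toM_ofM N (A : 'M[K]_N) : toM N (ofM A) = A.
Proof. by apply/matrixP => i j; rewrite mxE /ofM !valK; case: (A i j). Qed.

Lemma ReZ (r : R) (z : K) : complex.Re (r%:C * z) = r * complex.Re z.
Proof. by case: z => x y /=; rewrite mul0r subr0. Qed.
Lemma ImZ (r : R) (z : K) : complex.Im (r%:C * z) = r * complex.Im z.
Proof. by case: z => x y /=; rewrite mul0r addr0. Qed.

Lemma Un_cv_bigsum (I : Type) (s : seq I) (u : I -> nat -> R) (l : I -> R) :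
  (forall i, Un_cv (u i) (l i)) ->
  Un_cv (fun n => \sum_(i <- s) u i n) (\sum_(i <- s) l i).
Proof.
have cst c : Un_cv (fun=> c) c.
  by move=> e e0; exists 0%N => n _; rewrite /Rdist Rminus_diag Rabs_R0.
have ext v w c : (forall n, v n = w n) -> Un_cv v c -> Un_cv w c.
  by move=> vw H e /H [n0 hn]; exists n0 => n /hn; rewrite -vw.
move=> H; elim: s => [|i s IH].
  rewrite big_nil; apply: (ext (fun=> 0)); last exact: cst.
  by move=> t; rewrite big_nil.
rewrite big_cons; apply: (ext (fun n => Rplus (u i n) (\sum_(j <- s) u j n))).
  by move=> t; rewrite big_cons.
exact: CV_plus.
Qed.

(** All partial sums share the eigenbasis [U], so entrywise convergence reduces to the scalar
    exponential series. Uniqueness of limits then identifies the chosen matrix. *)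
Lemma mexp_spectral_mx N X (U : 'M[K]_N) h : U \is unitarymx -> toM N X = spectral_mx U h ->
  toM N (mexp N X) = spectral_mx U (fun i => exp (h i)).
Proof.
move=> uU XE; pose s x n := sum_f_R0 (fun k => Rmult (/ INR (Factorial.fact k)) (Rpow_def.pow x k)) n.
have powE k : toM N (mpow N X k) = spectral_mx U (fun i => Rpow_def.pow (h i) k).
  elim: k => [|k IH] /=; first by rewrite spectral_mx1 // toM_I.
  by rewrite toM_mul IH XE spectral_mxM.
have psumE n : toM N (exp_psum N X n) = spectral_mx U (fun i => s (h i) n).
  elim: n => [|n IH].
    rewrite toM_I -(spectral_mx1 uU); apply: eq_spectral_mx => i.
    by rewrite /s /= Rmult_1_r Rinv_1.
  change (exp_psum N X n.+1) with (madd (exp_psum N X n)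
    (mscale (Rinv (INR (Factorial.fact n.+1))) (mpow N X n.+1))).
  rewrite toM_add IH toM_scale powE spectral_mxZ spectral_mxD.
  by apply: eq_spectral_mx => i.
have scv x : Un_cv (s x) (exp x) by exact: proj2_sig (exist_exp x).
(* An arbitrary real-linear [c], so that one argument serves for real and imaginary parts. *)
have cvE (c : K -> R) : {morph c : x y / x + y} -> c 0 = 0 -> (forall r z, c (r%:C * z) = r * c z) ->
    forall i j, Un_cv (fun n => c (toM N (exp_psum N X n) i j)) (c (spectral_mx U (fun i => exp (h i)) i j)).
  move=> cD c0 cZ i j; rewrite spectral_mxE (big_morph c cD c0).
  have cst (r : R) : Un_cv (fun=> r) r.
    by move=> e e0; exists 0%N => n _; rewrite /Rdist Rminus_diag Rabs_R0.
  have cvk k : Un_cv (fun n => Rmult (s (h k) n) (c (U i k * (U j k)^*)))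
      (Rmult (exp (h k)) (c (U i k * (U j k)^*))).
    exact: CV_mult.
  under [X in Un_cv _ X]eq_bigr do rewrite cZ.
  have := Un_cv_bigsum (index_enum 'I_N) cvk.
  move=> H e /H [n0 hn]; exists n0 => n /hn.
  rewrite psumE spectral_mxE (big_morph c cD c0).
  by under eq_bigr do rewrite cZ.
have cvRe := cvE (@complex.Re R) (raddfD _) (raddf0 _) (fun r z => ReZ r z).
have cvIm := cvE (@complex.Im R) (raddfD _) (raddf0 _) (fun r z => ImZ r z).
have spec : exists E : Mat, forall i j, (i < N)%coq_nat -> (j < N)%coq_nat ->
    Un_cv (fun k => re (exp_psum N X k i j)) (re (E i j)) /\
    Un_cv (fun k => im (exp_psum N X k i j)) (im (E i j)).
  exists (ofM (spectral_mx U (fun i => exp (h i)))) => i j /ssrnat.ltP hi /ssrnat.ltP hj.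
  have := toM_ofM (spectral_mx U (fun i => exp (h i))) => /matrixP /(_ (Ordinal hi) (Ordinal hj)).
  rewrite mxE => Eij; split.
    have := cvRe (Ordinal hi) (Ordinal hj); rewrite -Eij.
    by move=> H e /H [n0 hn]; exists n0 => n /hn; rewrite mxE.
  have := cvIm (Ordinal hi) (Ordinal hj); rewrite -Eij.
  by move=> H e /H [n0 hn]; exists n0 => n /hn; rewrite mxE.
have := epsilon_spec inhMat _ spec; rewrite -/(mexp N X) => cvexp.
apply/matrixP => i j; rewrite [LHS]mxE.
have [||cRe cIm] := cvexp i j; try by apply/ssrnat.ltP; exact: ltn_ord.
apply/eqP; rewrite eq_complex; apply/andP; split; apply/eqP.
  apply: UL_sequence cRe _.
  by have := cvRe i j; move=> H e /H [n0 hn]; exists n0 => n /hn; rewrite mxE.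
apply: UL_sequence cIm _.
by have := cvIm i j; move=> H e /H [n0 hn]; exists n0 => n /hn; rewrite mxE.
Qed.

(** Applying [ln] to the eigenvalues of the exponential recovers those of [L]; a hermitian logarithm
    is therefore unique, which determines the choice behind [mlog]. *)
Lemma mexp_inj N (U : 'M[K]_N) a L : U \is unitarymx ->
  Defs.hermitian N L -> toM N (mexp N L) = spectral_mx U a -> toM N L = spectral_mx U (fun i => ln (a i)).
Proof.
move=> uU /toM_herm /hermitian_spectral_mx [V [h [uV LE]]].
rewrite (mexp_spectral_mx uV LE) LE => E.
rewrite -(spectral_mx_functional ln uV uU E); apply: eq_spectral_mx => i.
by rewrite /= ln_exp.
Qed.

Lemma mlog_spectral_mx N A (U : 'M[K]_N) a : U \is unitarymx -> (forall i, 0 < a i) ->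
  toM N A = spectral_mx U a -> toM N (mlog N A) = spectral_mx U (fun i => ln (a i)).
Proof.
move=> uU a0 AE.
have spec : exists L, Defs.hermitian N L /\ meq N (mexp N L) A.
  exists (ofM (spectral_mx U (fun i => ln (a i)))); split.
    by apply/toM_herm; rewrite toM_ofM spectral_mx_herm.
  apply/meqP; rewrite AE (mexp_spectral_mx uU (toM_ofM _)); apply: eq_spectral_mx => i.
  by apply: exp_ln; apply/RltP.
have := epsilon_spec inhMat _ spec; rewrite -/(mlog N A) => -[hL /meqP E].
by apply: mexp_inj => //; rewrite E.
Qed.

Lemma minv_spectral_mx N A (U : 'M[K]_N) a : U \is unitarymx -> (forall i, 0 < a i) ->
  toM N A = spectral_mx U a -> toM N (minv N A) = spectral_mx U (fun i => (a i)^-1).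
Proof.
move=> uU a0 AE.
have AV : toM N A *m spectral_mx U (fun i => (a i)^-1) = 1%:M.
  rewrite AE spectral_mxM // -(spectral_mx1 uU); apply: eq_spectral_mx => i.
  by rewrite divff // lt0r_neq0.
have spec : exists Y, meq N (mmul N A Y) mI.
  by exists (ofM (spectral_mx U (fun i => (a i)^-1))); apply/meqP; rewrite toM_mul toM_I toM_ofM.
have := epsilon_spec inhMat _ spec; rewrite -/(minv N A) => /meqP.
rewrite toM_mul toM_I => E; rewrite -[LHS]mul1mx -(mulmx1C AV) -mulmxA E.
by rewrite mulmx1.
Qed.

Lemma posdef_spectral_mx N A : posdef N A ->
  exists (U : 'M[K]_N) a, [/\ U \is unitarymx, forall i, 0 < a i & toM N A = spectral_mx U a].
Proof.
case=> /toM_herm /hermitian_spectral_mx [U [a [uU AE]]] pos; exists U, a; split => // k.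
(* The [k]-th column of [U]: it has norm one, hence is nonzero, and the quadratic form of [A] takes
   the value [a k] on it. *)
pose v i := if insub i is Some i' then
   mkC (complex.Re (U i' k)) (complex.Im (U i' k)) else C0.
have vE (i : 'I_N) : toC (v i) = U i k by rewrite /v valK; case: (U i k).
have nz : exists i, (i < N)%coq_nat /\ v i <> C0.
  have := unitary_mulVmx uU => /matrixP /(_ k k); rewrite !mxE eqxx => E.
  have [i nzi] : exists i, U i k != 0.
    apply/existsP; apply/existsPn => H; move/eqP: E; rewrite big1 ?oner_eq0 //.
      by rewrite eq_sym oner_eq0.
    by move=> i _; move: (H i); rewrite negbK => /eqP->; rewrite mulr0.
  exists (val i); split; first by apply/ssrnat.ltP; exact: ltn_ord.
  by move=> v0; move: nzi; rewrite -vE v0 eqxx.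
have := pos v nz => /RltP; congr (_ < _).
transitivity (complex.Re ((U^t* *m spectral_mx U a *m U) k k)).
  rewrite -AE; set S := Csum N _; change (re S) with (complex.Re (toC S)); congr complex.Re.
  rewrite /S toC_sum -mulmxA [RHS]mxE; apply: eq_bigr => i _.
  rewrite toC_sum [(_ *m U) i k]mxE mulr_sumr; apply: eq_bigr => j _.
  by rewrite !toC_mul toC_conj !mxE !vE.
rewrite /spectral_mx !mulmxA unitary_mulVmx // mul1mx -mulmxA unitary_mulVmx // mulmx1.
by rewrite !mxE eqxx.
Qed.

(** * The derivative of the matrix logarithm *)

(** The shift derivative of [logK (a + t) (p + t) - logK (a + t) (q + t)] is bounded by
    [|p - q| / (m (m + t)^2)], which is minus the derivative of [|p - q| / (m (m + t))]. Everything
    is small at infinity, so comparing derivatives compares the values at [t = 0]. *)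
Lemma logK_lipschitz m a b c : 0 < m -> m <= a -> m <= b -> m <= c ->
  `|logK a b - logK a c| <= `|b - c| / m ^+ 2.
Proof.
move=> m0 ma mb mc.
have half (p q : R) : m <= p -> m <= q -> logK a p - logK a q <= `|p - q| / m ^+ 2.
  move=> mp mq; pose F (t : R) : R := `|p - q| / m * logK (m + t) (m + t) - (logK (a + t) (p + t) - logK (a + t) (q + t)).
  pose F' (t : R) : R := `|p - q| / m * - ((m + t)^-1 * (m + t)^-1)
     - (- ((a + t)^-1 * (p + t)^-1) - - ((a + t)^-1 * (q + t)^-1)).
  suff : 0 <= F 0.
    rewrite /F !addr0 {1}/logK eqxx subr_ge0 => /le_trans; apply.
    by rewrite -mulrA -invfM expr2.
  have pt (x t : R) : m <= x -> 0 <= t -> m + t <= x + t /\ 0 < m + t.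
    by move=> toM t0; rewrite lerD2r; split => //; rewrite ltr_pwDl.
  apply: (nonincreasing_vanishing_ge0 (f' := F') (C := 1)).
  - move=> t t0.
    have [ha h] := pt _ _ ma t0; have [hp _] := pt _ _ mp t0; have [hq _] := pt _ _ mq t0.
    apply: derivable_pt_lim_minus; last apply: derivable_pt_lim_minus.
    + by apply: derivable_pt_lim_scal; apply: logK_derive.
    + by apply: logK_derive; apply: lt_le_trans h _.
    + by apply: logK_derive; apply: lt_le_trans h _.
  - move=> t t0.
    have [ha h] := pt _ _ ma t0; have [hp _] := pt _ _ mp t0; have [hq _] := pt _ _ mq t0.
    have hmt : m <= a + t by rewrite (le_trans ma) // lerDl.
    have a'0 := lt_le_trans h ha; have p'0 := lt_le_trans h hp; have q'0 := lt_le_trans h hq.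
    have -> : F' t = - (`|p - q| / (m * (m + t) ^+ 2) - (q - p) / ((a + t) * ((p + t) * (q + t)))).
      rewrite /F'; field.
      by rewrite !(lt0r_neq0 m0, lt0r_neq0 h, lt0r_neq0 a'0, lt0r_neq0 p'0, lt0r_neq0 q'0).
    rewrite oppr_le0 subr_ge0; apply: (le_trans (y := `|p - q| / ((a + t) * ((p + t) * (q + t))))).
      apply: ler_wpM2r; last by rewrite distrC ler_norm.
      by rewrite invr_ge0; do ?apply: mulr_ge0; apply: ltW.
    rewrite ler_wpM2l // lef_pV2 ?posrE ?mulr_gt0 ?exprn_gt0 //.
    apply: ler_pM => //; [exact: ltW|exact/ltW/exprn_gt0|].
    by rewrite expr2; apply: ler_pM => //; exact: ltW.
  - move=> t t0; have [ha h] := pt _ _ ma (ltW t0); have [hp _] := pt _ _ mp (ltW t0).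
    have [hq _] := pt _ _ mq (ltW t0).
    have tle (x : R) : m <= x -> t <= x + t by move=> toM; rewrite lerDr (le_trans (ltW m0)).
    have /andP[_ u1] := logK_bound t0 (tle _ ma) (tle _ mp).
    have /andP[u2 _] := logK_bound t0 (tle _ ma) (tle _ mq).
    have u3 : 0 <= `|p - q| / m * logK (m + t) (m + t).
      by rewrite mulr_ge0 ?divr_ge0 ?(ltW m0) //; case/andP: (logK_bound t0 (tle _ (lexx m)) (tle _ (lexx m))).
    by rewrite /F div1r; lra.
rewrite ler_norml half // andbT.
by have := half _ _ mc mb; rewrite distrC; lra.
Qed.

Lemma norm_unitary_conj_le N (U V A : 'M[K]_N) i j : U \is unitarymx -> V \is unitarymx ->
  `|(U *m A *m V) i j| <= \sum_k \sum_l `|A k l|.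
Proof.
move=> uU uV; rewrite mxE (le_trans (ler_norm_sum _ _ _)) //.
rewrite exchange_big; apply: ler_sum => l _; rewrite normrM mxE.
apply: (le_trans (y := `|\sum_k U i k * A k l|)).
  by rewrite ler_piMr // unitary_entry_le1.
apply: (le_trans (ler_norm_sum _ _ _)); apply: ler_sum => k _.
by rewrite normrM ler_piMl // unitary_entry_le1.
Qed.

(* An eigenvector of [U diag(a) U^* + r Y] is nearly supported on the eigenvectors of
   [U diag(a) U^*] with close eigenvalues, which replaces continuity of spectra. *)
Lemma perturbed_spectrum_close N (U V Y : 'M[K]_N) a b (r c : R) :
  U \is unitarymx -> V \is unitarymx -> \sum_k \sum_l `|Y k l| = c%:C ->
  spectral_mx V b = spectral_mx U a + r%:C *: Y ->
  forall k l, `|b l - a k|%:C * `|(U^t* *m V) k l| <= (`|r| * c)%:C.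
Proof.
move=> uU uV Yc E k l.
have := spectral_mx_sub a b k l uU uV; rewrite E opprD addrA subrr add0r.
rewrite mulmxN mulNmx -scalemxAr -scalemxAl 2!mxE => /(congr1 Num.norm).
rewrite normrN !normrM => H.
have nC (x : R) : `|x%:C : K| = `|x|%:C by rewrite normc_def /= expr0n addr0 sqrtr_sqr.
rewrite -distrC -nC -H nC rmorphM ler_wpM2l ?ler0c //= -Yc.
exact: norm_unitary_conj_le (unitary_adj uU) uV.
Qed.

(* A column of norm one has an entry of modulus at least [1 / N]. *)
Lemma unitary_col_entry N (W : 'M[K]_N) l : W \is unitarymx ->
  exists k, (1 : K) <= N%:R * `|W k l|.
Proof.
move=> uW; have := unitary_mulVmx uW => /matrixP /(_ l l); rewrite !mxE eqxx => E.
suff [k lek] : exists k, ~~ (N%:R * `|W k l| < 1).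
  by exists k; rewrite real_leNgt ?realE ?ler01 ?mulr_ge0.
apply/existsP; apply/existsPn => H.
have : (\sum_(k < N) 1 : K) = N%:R by rewrite sumr_const card_ord.
have N0 : (0 < N)%N by exact: leq_ltn_trans (leq0n l) (ltn_ord l).
have : \sum_k (`|W k l| * N%:R) < \sum_(k < N) (1 : K).
  apply: ltr_sum; first by apply/hasP; exists l; rewrite ?mem_index_enum.
  by move=> k _; rewrite mulrC; move: (H k); rewrite negbK.
rewrite -mulr_suml sumr_const card_ord => H1 _.
have N0' : (0 : K) < N%:R by rewrite ltr0n.
move: H1; rewrite -[X in _ < X]mul1r ltr_pM2r // => /lt_le_trans.
have : (1 : K) <= \sum_k `|W k l|.
  rewrite -[X in X <= _]E; apply: ler_sum => k _.
  rewrite !mxE mulrC -normCK expr2 ler_piMr // unitary_entry_le1 //.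
by move=> h /(_ _ h); rewrite ltxx.
Qed.

(* [T_X(Y)] for [X = U diag(a) U^*]. *)
Definition logD N (U : 'M[K]_N) (a : 'I_N -> R) (Y : 'M[K]_N) : 'M[K]_N :=
  U *m (\matrix_(i, j) ((logK (a i) (a j))%:C * (U^t* *m Y *m U) i j)) *m U^t*.

(** With [W = U^* V] and [Y' = U^* Y U], the error read between the two eigenbases has entries [r *
    sum_p Y'_kp W_pl (K(a_k,b_l) - K(a_k,a_p))]. The Lipschitz bound brings out [|b_l - a_p|], and
    [|b_l - a_p| |W_pl|] is at most [|r| c], so a second factor [r] appears. *)
Lemma spectral_mx_ln_expand N (U Y : 'M[K]_N) a : U \is unitarymx -> (forall i, 0 < a i) ->
  exists C delta : R, 0 < delta /\ forall r, `|r| < delta -> forall V b, V \is unitarymx ->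
    spectral_mx V b = spectral_mx U a + r%:C *: Y -> (forall l, 0 < b l) /\
    forall i j, `|(spectral_mx V (fun k => ln (b k)) - spectral_mx U (fun k => ln (a k)) - r%:C *: logD U a Y) i j|
       <= (C * r ^+ 2)%:C.
Proof.
move=> uU a0.
(* A positive lower bound for all [a i] that also makes sense for an empty index set. *)
pose m := (1 + \sum_i (a i)^-1)^-1.
have sV i : (a i)^-1 <= 1 + \sum_i (a i)^-1.
  rewrite (bigD1 i) //= addrA [1 + _]addrC -addrA lerDl addr_ge0 // sumr_ge0 // => k _.
  by rewrite invr_ge0 ltW.
have m0 : 0 < m by rewrite invr_gt0 ltr_pwDl // sumr_ge0 // => k _; rewrite invr_ge0 ltW.
have ma i : m <= a i.
  by rewrite -[a i]invrK lef_pV2 ?posrE ?invr_gt0 // -invr_gt0.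
have [c c0 Yc] : exists2 c : R, 0 <= c & \sum_k \sum_l `|Y k l| = c%:C.
  have S0 : 0 <= \sum_k \sum_l `|Y k l| by do 2![apply: sumr_ge0 => ? _].
  exists (complex.Re (\sum_k \sum_l `|Y k l|)); last by rewrite RRe_real // ger0_real.
  by rewrite -ler0c RRe_real // ger0_real.
pose m2 := m / 2; have m20 : 0 < m2 by rewrite divr_gt0.
pose L := (m2 ^+ 2)^-1.
have L0 : 0 <= L by rewrite invr_ge0 exprn_ge0 // ltW.
(* The radius guarantees [N |r| c < m / 2]. As each [b l] lies within [N |r| c] of some [a k], it
   stays above [m2 = m / 2], where the Lipschitz constant is [L]. *)
exists (\sum_(k < N) \sum_(l < N) \sum_(p < N) (c * c * L)), (m2 / (N%:R * c + 1)).
have Nc0 : 0 < N%:R * c + 1 by rewrite ltr_pwDr // mulr_ge0.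
split; first by rewrite divr_gt0.
move=> r rdelta V b uV E; set W := U^t* *m V.
have uW : W \is unitarymx by exact: mul_unitarymx (unitary_adj uU) uV.
have close := perturbed_spectrum_close uU uV Yc E.
have bm l : m2 <= b l.
  have [k hk] := unitary_col_entry l uW.
  have : `|b l - a k|%:C <= (N%:R * (`|r| * c))%:C :> K.
    apply: (le_trans (y := `|b l - a k|%:C * (N%:R * `|W k l|))).
      by rewrite ler_peMr // ler0c.
    by rewrite mulrCA rmorphM rmorph_nat ler_wpM2l.
  rewrite lecR => h1.
  have : `|r| * (N%:R * c + 1) < m2 by rewrite -ltr_pdivlMr.
  rewrite mulrDr mulr1 mulrCA => h2.
  have := ler_norm (a k - b l); rewrite distrC; have := ma k; have := normr_ge0 r.
  by rewrite /m2 in h2 *; lra.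
have b0 l : 0 < b l by exact: lt_le_trans m20 (bm l).
split => // i j.
set D := _ - _; pose Y' := U^t* *m Y *m U.
have WE k l : (U^t* *m D *m V) k l =
    r%:C * \sum_p Y' k p * (W p l * (logK (a k) (b l) - logK (a k) (a p))%:C).
  have YV : U^t* *m Y *m V = Y' *m W.
    by rewrite /Y' /W mulmxA -[_ *m U *m U^t*]mulmxA (unitarymxP uU) mulmx1.
  have T1 : (U^t* *m (spectral_mx V (fun k => ln (b k)) - spectral_mx U (fun k => ln (a k))) *m V) k l =
      r%:C * ((logK (a k) (b l))%:C * (Y' *m W) k l).
    have := spectral_mx_sub a b k l uU uV; rewrite E opprD addrA subrr add0r.
    rewrite mulmxN mulNmx -scalemxAr -scalemxAl YV 2!mxE => H.
    rewrite -(opprB (spectral_mx U _) (spectral_mx V _)) mulmxN mulNmx mxE (spectral_mx_sub _ _ _ _ uU uV) -logK_sub rmorphM /=.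
    by rewrite mulrAC -H; ring.
  rewrite /D mulmxBr mulmxBl mxE T1 [X in _ + X]mxE -scalemxAr -scalemxAl.
  rewrite [X in _ - X]mxE /logD !mulmxA unitary_mulVmx // mul1mx.
  rewrite -mulrBr; congr (_ * _).
  pose M : 'M[K]_N := \matrix_(i, j) ((logK (a i) (a j))%:C * Y' i j).
  have ME p : M k p = (logK (a k) (a p))%:C * Y' k p by rewrite mxE.
  rewrite -/Y' -/M -(mulmxA Y') -(mulmxA M) -/W [(Y' *m W) k l]mxE [X in _ - X]mxE mulr_sumr -sumrB; apply: eq_bigr => p _.
  rewrite ME rmorphB /=; ring.
have DE : D = U *m (U^t* *m D *m V) *m V^t*.
  by rewrite !mulmxA (unitarymxP uU) mul1mx -mulmxA (unitarymxP uV) mulmx1.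
rewrite DE; apply: (le_trans (norm_unitary_conj_le _ _ _ uU (unitary_adj uV))).
rewrite mulr_suml rmorph_sum; apply: ler_sum => k _.
rewrite mulr_suml rmorph_sum; apply: ler_sum => l _.
rewrite WE mulr_sumr; apply: (le_trans (ler_norm_sum _ _ _)).
rewrite mulr_suml rmorph_sum; apply: ler_sum => p _.
have nC (x : R) : `|x%:C : K| = `|x|%:C by rewrite normc_def /= expr0n addr0 sqrtr_sqr.
rewrite !normrM !nC.
have Y'c : `|Y' k p| <= c%:C.
  by rewrite -Yc; exact: norm_unitary_conj_le (unitary_adj uU) uU.
have Lip : `|logK (a k) (b l) - logK (a k) (a p)| <= `|b l - a p| * L.
  have m2m : m2 <= m by rewrite /m2 ler_pdivrMr // ler_peMr ?(ltW m0) // ler1n.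
  by apply: logK_lipschitz => //; apply: le_trans m2m _.
apply: (le_trans (y := `|r|%:C * (c%:C * ((`|r| * c)%:C * L%:C)))); last first.
  rewrite -!rmorphM lecR -(real_normK (num_real r)).
  by rewrite [leLHS](_ : _ = c * c * L * `|r| ^+ 2) //; ring.
apply: ler_wpM2l; first by rewrite ler0c.
apply: ler_pM => //; first by rewrite mulr_ge0 // ler0c.
apply: (le_trans (y := `|W p l| * (`|b l - a p| * L)%:C)).
  by rewrite ler_wpM2l // lecR.
rewrite rmorphM mulrA ler_wpM2r ?ler0c //.
by rewrite mulrC; exact: close.
Qed.

Lemma quadratic_error_derivable (f : R -> R) (l C delta : R) : 0 < delta ->
  (forall r, `|r| < delta -> `|f r - f 0 - r * l| <= C * r ^+ 2) -> derivable_pt_lim f 0 l.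
Proof.
move=> d0 H e /RltP e0.
have C0 : 0 < `|C| + 1 by rewrite ltr_pwDr.
have de0 : 0 < Num.min delta (e / (`|C| + 1)) by rewrite lt_min d0 divr_gt0.
exists (mkposreal _ (elimT RltP de0)) => r /eqP r0 /=; rewrite !RealsE => /RltP.
rewrite lt_min => /andP[rd re].
apply/RltP; have := H r rd; rewrite add0r => h.
have -> : (f r - f 0) / r - l = (f r - f 0 - r * l) / r by field.
rewrite normrM normfV ltr_pdivrMr ?normr_gt0 //; apply: (le_lt_trans h).
rewrite -(real_normK (num_real r)) expr2 mulrA ltr_pM2r ?normr_gt0 //.
apply: (le_lt_trans (y := (`|C| + 1) * `|r|)); last by rewrite mulrC -ltr_pdivlMr.
rewrite ler_wpM2r //; have := ler_norm C; lra.
Qed.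

Lemma conjC_R (r : R) : (r%:C : K)^* = r%:C.
Proof. by apply/CrealP; rewrite complex_real. Qed.

Lemma norm_Im_le (z : K) : `|complex.Im z|%:C <= `|z|.
Proof.
have := normc_ge_Re (z * Complex 0 1); rewrite ReiNIm normrN => /le_trans; apply.
by rewrite normrM [X in _ * X]normc_def /= expr0n expr1n add0r sqrtr1 mulr1.
Qed.

(** Since [Y] is hermitian, every [X + r Y] is diagonalizable, so for small [r] its logarithm is
    computed on eigenvalues. The quadratic error bound yields the entrywise derivatives, and their
    uniqueness identifies the chosen matrix. *)
Lemma mT_spectral_mx N X Y (U : 'M[K]_N) a : U \is unitarymx -> (forall i, 0 < a i) ->
  toM N X = spectral_mx U a -> Defs.hermitian N Y -> toM N (mT N X Y) = logD U a (toM N Y).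
Proof.
move=> uU a0 XE /toM_herm hY.
have [C [delta [d0 HC]]] := spectral_mx_ln_expand (toM N Y) uU a0.
pose L r := toM N (mlog N (madd X (mscale r Y))).
have XrE r : toM N (madd X (mscale r Y)) = spectral_mx U a + r%:C *: toM N Y.
  by rewrite toM_add toM_scale XE.
have L0 : L 0 = spectral_mx U (fun k => ln (a k)).
  by apply: mlog_spectral_mx => //; rewrite XrE rmorph0 scale0r addr0.
have LC r : `|r| < delta -> forall i j,
    `|(L r - L 0 - r%:C *: logD U a (toM N Y)) i j| <= (C * r ^+ 2)%:C.
  move=> rd i j; have : (toM N (madd X (mscale r Y)))^t* = toM N (madd X (mscale r Y)).
    by rewrite XrE linearD /= map_mxD spectral_mx_herm linearZ /= map_mxZ hY; congr (_ + _ *: _); exact: conjC_R.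
  move=> /hermitian_spectral_mx [V [b [uV E]]].
  have [b0 H] := HC r rd V b uV (etrans (esym E) (XrE r)).
  by rewrite L0 /L (mlog_spectral_mx uV b0 E).
have der (c : K -> R) (D : Mat) (cD : {morph c : x y / x - y}) : 
    (forall r z, c (r%:C * z) = r * c z) -> (forall z, `|c z|%:C <= `|z|) -> 
    toM N D = logD U a (toM N Y) ->
    forall i j, derivable_pt_lim (fun r => c (L r i j)) 0 (c (toM N D i j)).
  move=> cZ cN -> i j; apply: (quadratic_error_derivable d0) => r rd.
  rewrite -cZ -!cD -lecR; apply: (le_trans _ (LC r rd i j)).
  by apply: le_trans (cN _) _; rewrite !mxE.
have derRe D := der (@complex.Re R) D (raddfB _) (fun r z => ReZ r z) (@normc_ge_Re R).
have derIm D := der (@complex.Im R) D (raddfB _) (fun r z => ImZ r z) norm_Im_le.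
have ext f g l x : (forall t, f t = g t) -> derivable_pt_lim f x l -> derivable_pt_lim g x l.
  exact: derivable_pt_lim_ext.
have spec D : toM N D = logD U a (toM N Y) -> forall i j, (i < N)%coq_nat -> (j < N)%coq_nat ->
    derivable_pt_lim (fun r => re (mlog N (madd X (mscale r Y)) i j)) 0 (re (D i j)) /\
    derivable_pt_lim (fun r => im (mlog N (madd X (mscale r Y)) i j)) 0 (im (D i j)).
  move=> DE i j /ssrnat.ltP hi /ssrnat.ltP hj; split.
    have := derRe D DE (Ordinal hi) (Ordinal hj); rewrite mxE.
    by apply: ext => t; rewrite /L mxE.
  have := derIm D DE (Ordinal hi) (Ordinal hj); rewrite mxE.
  by apply: ext => t; rewrite /L mxE.
have exD : exists D : Mat, forall i j, (i < N)%coq_nat -> (j < N)%coq_nat ->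
    derivable_pt_lim (fun r => re (mlog N (madd X (mscale r Y)) i j)) 0 (re (D i j)) /\
    derivable_pt_lim (fun r => im (mlog N (madd X (mscale r Y)) i j)) 0 (im (D i j)).
  by exists (ofM (logD U a (toM N Y))); apply: spec (toM_ofM _).
have := epsilon_spec inhMat _ exD; rewrite -/(mT N X Y) => cv.
rewrite -(toM_ofM (logD U a (toM N Y))); apply/meqP => i j hi hj.
have [r1 i1] := spec _ (toM_ofM _) i j hi hj; have [r2 i2] := cv i j hi hj.
apply: toC_inj; apply/eqP; rewrite eq_complex /=; apply/andP; split; apply/eqP.
  exact: uniqueness_limite r2 r1.
exact: uniqueness_limite i2 i1.
Qed.

(** * Tensor products *)

Section Tensor.
Variable d : nat.
Hypothesis d0 : (0 < d)%N.

(* Entries outside the index range are zero. *)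
Definition entry N (A : 'M[K]_N) : nat -> nat -> K := fun i j =>
  if (insub i, insub j) is (Some i', Some j') then A i' j' else 0.
Definition tabM N (F : nat -> nat -> K) : 'M[K]_N := \matrix_(i, j) F i j.
(** Tensor products are taken of functions on natural numbers, so that regrouping factors needs no
    transport along equations between dimensions; [eqF] compares the results on the relevant
    range. *)
Definition kronF (b : nat) (A B : nat -> nat -> K) : nat -> nat -> K := fun i j =>
  A (Nat.div i b) (Nat.div j b) * B (Nat.modulo i b) (Nat.modulo j b).
Definition delta : nat -> nat -> K := fun i j => (i == j)%:R.
Definition eqF N (A B : nat -> nat -> K) := forall i j, (i < N)%N -> (j < N)%N -> A i j = B i j.

Lemma eqF_tabM N A B : eqF N A B <-> tabM N A = tabM N B.
Proof.
split=> [H|/matrixP H i j hi hj]; first by apply/matrixP => i j; rewrite !mxE H.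
by have := H (Ordinal hi) (Ordinal hj); rewrite !mxE.
Qed.
Lemma tabM_entry N (A : 'M[K]_N) : tabM N (entry A) = A.
Proof. by apply/matrixP => i j; rewrite mxE /entry !valK. Qed.
Lemma entryE N (A : 'M[K]_N) (i j : 'I_N) : entry A i j = A i j.
Proof. by rewrite /entry !valK. Qed.
Lemma entry_outl N (A : 'M[K]_N) i j : (N <= i)%N -> entry A i j = 0.
Proof. by move=> h; rewrite /entry [insub i]insubN // -leqNgt. Qed.
Lemma entry_outr N (A : 'M[K]_N) i j : (N <= j)%N -> entry A i j = 0.
Proof. by move=> h; rewrite /entry [insub j]insubN -?leqNgt //; case: insub. Qed.
Lemma entry_mul N (A B : 'M[K]_N) i j : entry (A *m B) i j = \sum_(t < N) entry A i t * entry B t j.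
Proof.
have [hi|hi] := ltnP i N; last first.
  by rewrite entry_outl // big1 // => t _; rewrite entry_outl // mul0r.
have [hj|hj] := ltnP j N; last first.
  by rewrite entry_outr // big1 // => t _; rewrite [X in _ * X]entry_outr // mulr0.
have /= -> := entryE (A *m B) (Ordinal hi) (Ordinal hj); rewrite mxE.
apply: eq_bigr => t _.
by have /= <- := entryE A (Ordinal hi) t; have /= <- := entryE B t (Ordinal hj).
Qed.
Lemma entry_tr N (A : 'M[K]_N) i j : entry A^T i j = entry A j i.
Proof. by rewrite /entry; case: (@insub _ _ 'I_N i) => [i'|]; case: (@insub _ _ 'I_N j) => [j'|] //; rewrite mxE. Qed.
Lemma entry_map N (A : 'M[K]_N) (f : {rmorphism K -> K}) i j : entry (map_mx f A) i j = f (entry A i j).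
Proof. by rewrite /entry; case: (@insub _ _ 'I_N i) => [i'|]; case: (@insub _ _ 'I_N j) => [j'|]; rewrite ?rmorph0 // mxE. Qed.

Lemma big_ord_mul (V : nmodType) a b (F : nat -> V) :
  \sum_(i < a * b) F i = \sum_(x < a) \sum_(y < b) F (x * b + y)%N.
Proof.
rewrite -(big_mkord xpredT F) big_nat_mul big_mkord; apply: eq_bigr => x _.
rewrite mulSn -{1}[(x * b)%N]add0n big_addn addnK big_mkord.
by apply: eq_bigr => y _; rewrite addnC.
Qed.

Lemma divMDl b x y : (y < b)%N -> Nat.div (x * b + y) b = x.
Proof.
move=> yb; rewrite Nat.div_add_l; last by case: b yb.
by rewrite Nat.div_small ?Nat.add_0_r //; apply/ssrnat.ltP.
Qed.
Lemma modMDl b x y : (y < b)%N -> Nat.modulo (x * b + y) b = y.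
Proof.
move=> yb; rewrite -[(x * b + y)%N]/(Nat.add (Nat.mul x b) y) Nat.add_comm Nat.Div0.mod_add.
by rewrite Nat.mod_small //; apply/ssrnat.ltP.
Qed.
Lemma div_lt a b i : (i < a * b)%N -> (Nat.div i b < a)%N.
Proof.
move=> h; apply/ssrnat.ltP/Nat.Div0.div_lt_upper_bound.
by apply/ssrnat.ltP; rewrite -[Nat.mul b a]/(b * a)%N mulnC.
Qed.
Lemma mod_lt b i : (0 < b)%N -> (Nat.modulo i b < b)%N.
Proof. by move=> b0; apply/ssrnat.ltP/Nat.mod_upper_bound; case: b b0. Qed.

Lemma kronF_mul a b A A' B B' i j :
  \sum_(t < a * b) kronF b A B i t * kronF b A' B' t j =
  kronF b (fun i j => \sum_(t < a) A i t * A' t j) (fun i j => \sum_(t < b) B i t * B' t j) i j.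
Proof.
rewrite (big_ord_mul a b (fun t => kronF b A B i t * kronF b A' B' t j)) /kronF big_distrlr /=.
apply: eq_bigr => x _; apply: eq_bigr => y _.
by rewrite divMDl // modMDl // mulrACA.
Qed.

Lemma kronF_assoc b c A B C i j : (0 < c)%N ->
  kronF (b * c) A (kronF c B C) i j = kronF c (kronF b A B) C i j.
Proof.
move=> c0; have cn : c <> 0%N by case: c c0.
have E k : Nat.div k (b * c)%N = Nat.div (Nat.div k c) b.
  by rewrite Nat.Div0.div_div -[Nat.mul c b]/(c * b)%N mulnC.
have M k : Nat.modulo k (b * c)%N = (Nat.modulo (Nat.div k c) b * c + Nat.modulo k c)%N.
  rewrite mulnC -[(c * b)%N]/(Nat.mul c b) Nat.Div0.mod_mul_r.
  by rewrite addnC [(_ * c)%N]mulnC.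
have ml k : (Nat.modulo k c < c)%N by exact: mod_lt.
by rewrite /kronF !E !M !divMDl // !modMDl // mulrA.
Qed.

Lemma kronF_eqF a b A A' B B' : (0 < b)%N -> eqF a A A' -> eqF b B B' -> eqF (a * b) (kronF b A B) (kronF b A' B').
Proof.
move=> b0 HA HB i j hi hj; rewrite /kronF HA ?HB //; try exact: mod_lt; exact: div_lt.
Qed.

Lemma kronF_delta a b : (0 < b)%N -> eqF (a * b) (kronF b delta delta) delta.
Proof.
move=> b0 i j hi hj; rewrite /kronF /delta -natrM mulnb; congr (nat_of_bool _)%:R.
apply/andP/eqP => [[/eqP h1 /eqP h2]|->//].
by rewrite (Nat.div_mod_eq i b) (Nat.div_mod_eq j b) h1 h2.
Qed.

(* [A 0 (x) ... (x) A (k - 1)] *)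
Fixpoint tensor (k : nat) (A : nat -> 'M[K]_d) : nat -> nat -> K :=
  if k is k'.+1 then kronF (Nat.pow d k') (entry (A 0%N)) (tensor k' (fun j => A j.+1)) else delta.

Lemma pow_gt0 k : (0 < Nat.pow d k)%N.
Proof. by elim: k => //= k IH; rewrite muln_gt0 d0. Qed.
Lemma powD k l : Nat.pow d (k + l) = (Nat.pow d k * Nat.pow d l)%N.
Proof. by rewrite -[(k + l)%N]/(Nat.add k l) Nat.pow_add_r. Qed.

Lemma eq_tensor k A B : (forall j, (j < k)%N -> A j = B j) -> tensor k A =2 tensor k B.
Proof.
elim: k A B => [//|k IH] A B H i j; rewrite /= /kronF H // (IH _ (fun j => B j.+1)) //.
by move=> x xk; apply: H.
Qed.

Lemma entry1 N : eqF N (entry (1%:M : 'M[K]_N)) delta.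
Proof. by apply/eqF_tabM; rewrite tabM_entry; apply/matrixP => i j; rewrite !mxE. Qed.

Lemma tensor1 k A : (forall j, A j = 1%:M) -> eqF (Nat.pow d k) (tensor k A) delta.
Proof.
elim: k A => [|k IH] A A1 //= i j hi hj; rewrite A1 -(kronF_delta (pow_gt0 k) hi hj).
by apply: (kronF_eqF (pow_gt0 k) (@entry1 d) (IH _ (fun j => A1 j.+1))).
Qed.

Lemma tensor_add k l A : eqF (Nat.pow d (k + l)) (tensor (k + l) A)
  (kronF (Nat.pow d l) (tensor k A) (tensor l (fun j => A (k + j)%N))).
Proof.
elim: k A => [|k IH] A.
  move=> i j hi hj; rewrite /kronF /= /delta.
  rewrite (Nat.div_small i) ?(Nat.div_small j) ?(Nat.mod_small i) ?(Nat.mod_small j); try exact/ssrnat.ltP.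
  by rewrite eqxx [RHS]mul1r.
move=> i j hi hj; rewrite [RHS]/= -kronF_assoc ?pow_gt0 // -powD /= /kronF.
by rewrite IH ?mod_lt ?pow_gt0.
Qed.

Lemma tensor_mul k A B : eqF (Nat.pow d k)
  (fun i j => \sum_(t < Nat.pow d k) tensor k A i t * tensor k B t j) (tensor k (fun x => A x *m B x)).
Proof.
elim: k A B => [|k IH] A B i j.
  rewrite !ltnS !leqn0 => /eqP-> /eqP->.
  by rewrite big_ord1 /= /delta eqxx mulr1.
move=> hi hj; rewrite /= -[Nat.mul d _]/(d * Nat.pow d k)%N kronF_mul /kronF entry_mul.
by congr (_ * _); apply: IH; apply: mod_lt; exact: pow_gt0.
Qed.

Lemma tensor_tr k A i j : tensor k (fun x => (A x)^T) i j = tensor k A j i.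
Proof.
elim: k A i j => [|k IH] A i j; first by rewrite /= /delta eq_sym.
by rewrite /= /kronF entry_tr (IH (fun x => A x.+1)).
Qed.

(** The default 1 keeps these numbers positive at every index. *)
Definition eig_of_nat (a : 'I_d -> R) (i : nat) : R := if insub i is Some i' then a i' else 1.
(* The eigenvalues of a tensor product of matrices with spectra [a 0], [a 1], ... *)
Fixpoint tensor_eig (k : nat) (a : nat -> 'I_d -> R) (i : nat) : R :=
  if k is k'.+1 then eig_of_nat (a 0%N) (Nat.div i (Nat.pow d k')) * tensor_eig k' (fun j => a j.+1) (Nat.modulo i (Nat.pow d k'))
  else 1.

Lemma eig_of_nat_gt0 a i : (forall i, 0 < a i) -> 0 < eig_of_nat a i.
Proof. by move=> a0; rewrite /eig_of_nat; case: insub. Qed.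
Lemma tensor_eig_gt0 k a i : (forall j i, 0 < a j i) -> 0 < tensor_eig k a i.
Proof.
elim: k a i => [//|k IH] a i a0 /=.
by rewrite mulr_gt0 ?eig_of_nat_gt0 //; apply: IH.
Qed.

Lemma entry_spectral_mx (U : 'M[K]_d) f i j :
  entry (spectral_mx U f) i j = \sum_(t < d) (f t)%:C * (entry U i t * (entry U j t)^*).
Proof.
rewrite /spectral_mx !entry_mul; apply: eq_bigr => t _; rewrite entry_mul entry_map entry_tr.
rewrite (bigD1 t) //= big1 => [|s st]; last first.
  by rewrite [entry (diag_mx _) _ _]entryE !mxE (negPf st) mulr0.
by rewrite [entry (diag_mx _) _ _]entryE !mxE eqxx addr0 -mulrA mulrCA.
Qed.

(** The columns of the tensor product of the [U x] carry products of eigenvalues, and a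
    multiplicative [F] lets the sum over them factor. It is used for the identity, the constant 1
    and integer powers. *)
Lemma tensor_spectral_mx (F : R -> R) k U a i j : F 1 = 1 ->
  (forall x y, 0 < x -> 0 < y -> F (x * y) = F x * F y) -> (forall j i, 0 < a j i) ->
  (i < Nat.pow d k)%N -> (j < Nat.pow d k)%N ->
  \sum_(t < Nat.pow d k) (F (tensor_eig k a t))%:C * (tensor k U i t * (tensor k U j t)^*) =
  tensor k (fun x => spectral_mx (U x) (fun i => F (a x i))) i j.
Proof.
move=> F1 FM; elim: k U a i j => [|k IH] U a i j a0.
  rewrite !ltnS !leqn0 => /eqP-> /eqP->.
  by rewrite big_ord1 /= /delta eqxx F1 !mul1r conjC1.
move=> hi hj; rewrite /= -[Nat.mul d _]/(d * Nat.pow d k)%N.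
set b := Nat.pow d k; have b0 : (0 < b)%N := pow_gt0 k.
rewrite (big_ord_mul d b (fun t => (F (eig_of_nat (a 0%N) (Nat.div t b) * tensor_eig k (fun j => a j.+1) (Nat.modulo t b)))%:C *
  (kronF b (entry (U 0%N)) (tensor k (fun j => U j.+1)) i t * (kronF b (entry (U 0%N)) (tensor k (fun j => U j.+1)) j t)^*))).
have /= IH' := IH (fun x => U x.+1) (fun x => a x.+1).
rewrite [RHS]/kronF -IH' ?mod_lt // entry_spectral_mx big_distrlr /=.
apply: eq_bigr => x _; apply: eq_bigr => y _.
rewrite /kronF divMDl // modMDl // FM ?eig_of_nat_gt0 ?tensor_eig_gt0 // rmorphM /= rmorphM /=.
rewrite {1}/eig_of_nat valK /= -/b; ring.
Qed.
End Tensor.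

Lemma pow2S m : Nat.pow 2 m.+1 = (Nat.pow 2 m + Nat.pow 2 m)%N.
Proof. by rewrite -[Nat.pow 2 m.+1]/(2 * Nat.pow 2 m)%N mul2n addnn. Qed.

(** * Contraction with the maximally entangled vector *)

Lemma bparS f j : bpar f.+1 j.+1 = xorb (Nat.odd j.+1) (bpar f (Nat.div2 j.+1)).
Proof. by []. Qed.

Lemma div2_le j : (Nat.div2 j.+1 <= j)%N.
Proof. by apply/ssrnat.leP/Nat.lt_succ_r/Nat.lt_div2/Nat.lt_0_succ. Qed.

Lemma bpar_fuel f j : (j <= f)%N -> bpar f j = beta j.
Proof.
rewrite /beta; have [n] := ubnP j; elim: n f j => [//|n IH] [|f] [|j] // jn jf.
have h := div2_le j.
have hn : (Nat.div2 j.+1 < n)%N by exact: leq_ltn_trans h _.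
by rewrite !bparS (IH f) ?(leq_trans h) // (IH j).
Qed.

Lemma betaE j : beta j = xorb (Nat.odd j) (beta (Nat.div2 j)).
Proof. by case: j => [//|j]; rewrite {1}/beta bparS bpar_fuel // div2_le. Qed.

(** [beta] is the parity of the number of binary digits 1, and [2^m] adds one such digit above those
    of [j]. The induction removes the lowest digit. *)
Lemma beta_add_pow2 m j : (j < Nat.pow 2 m)%N -> beta (j + Nat.pow 2 m) = ~~ beta j.
Proof.
elim: m j => [|m IH] j jm; first by move: jm; rewrite ltnS leqn0 => /eqP->.
rewrite betaE [in RHS]betaE.
have -> : (j + Nat.pow 2 m.+1)%N = Nat.add j (Nat.mul 2 (Nat.pow 2 m)) by [].
rewrite Nat.odd_add_mul_2 !Nat.div2_div [Nat.mul 2 _]Nat.mul_comm Nat.div_add //.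
rewrite -[Nat.add _ _]/(Nat.div j 2 + Nat.pow 2 m)%N IH; first by case: Nat.odd; case: beta.
by apply: div_lt; rewrite muln2 -addnn -pow2S.
Qed.

Local Arguments Nat.pow : simpl never.

(** * Contracting elementary tensors and sums of one-factor terms *)

Section Contraction.
Variable d : nat.
Hypothesis d0 : (0 < d)%N.
Notation dd m := (Nat.pow d (Nat.pow 2 m)).

Lemma ddS m : dd m.+1 = (dd m * dd m)%N.
Proof. by rewrite pow2S powD. Qed.

Lemma dd0 : dd 0 = d.
Proof. exact: Nat.mul_1_r. Qed.

(* [sum_x 1 (x) ... (x) L x (x) ... (x) 1] *)
Fixpoint tensor_sum (k : nat) (L : nat -> 'M[K]_d) (i j : nat) : K :=
  if k is k'.+1 then kronF (Nat.pow d k') (entry (L 0%N)) delta i j + kronF (Nat.pow d k') delta (tensor_sum k' (fun x => L x.+1)) i j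
  else 0.

Lemma tensor_unitary k (U : nat -> 'M[K]_d) i j : (forall x, U x \is unitarymx) ->
  (i < Nat.pow d k)%N -> (j < Nat.pow d k)%N ->
  \sum_(t < Nat.pow d k) tensor k U i t * (tensor k U j t)^* = delta i j.
Proof.
move=> uU hi hj.
have := tensor_spectral_mx d0 (F := fun=> 1) U (a := fun _ _ => 1) (erefl _) _ (fun _ _ => ltr01) hi hj.
rewrite (tensor1 d0 (k := k) (fun x => spectral_mx1 (uU x)) hi hj) => <-; last by move=> x y _ _; rewrite mulr1.
by apply: eq_bigr => t _; rewrite mul1r.
Qed.

(** [ln] turns the product of eigenvalues into a sum in which each term touches one factor;
    unitarity turns the remaining factors into identities. *)
Lemma tensor_sum_ln k U a i j : (forall x, U x \is unitarymx) -> (forall j i, 0 < a j i) ->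
  (i < Nat.pow d k)%N -> (j < Nat.pow d k)%N ->
  \sum_(t < Nat.pow d k) (ln (tensor_eig k a t))%:C * (tensor k U i t * (tensor k U j t)^*) =
  tensor_sum k (fun x => spectral_mx (U x) (fun i => ln (a x i))) i j.
Proof.
elim: k U a i j => [|k IH] U a i j uU a0.
  rewrite !ltnS !leqn0 => /eqP-> /eqP->.
  by rewrite big_ord1 /= (_ : ln 1 = 0) ?mul0r // ln_1.
move=> hi hj; rewrite /= -[Nat.pow d k.+1]/(d * Nat.pow d k)%N.
set b := Nat.pow d k; have b0 : (0 < b)%N := pow_gt0 d0 k.
rewrite (big_ord_mul d b (fun t => (ln (eig_of_nat (a 0%N) (Nat.div t b) * tensor_eig k (fun j => a j.+1) (Nat.modulo t b)))%:C *
  (kronF b (entry (U 0%N)) (tensor k (fun j => U j.+1)) i t * (kronF b (entry (U 0%N)) (tensor k (fun j => U j.+1)) j t)^*))).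
have /= IH' := IH (fun x => U x.+1) (fun x => a x.+1).
rewrite [X in _ = X + _]/kronF [X in _ = _ + X]/kronF -IH' ?mod_lt // entry_spectral_mx.
have uU' x : U x.+1 \is unitarymx by [].
rewrite -(tensor_unitary uU' (mod_lt i b0) (mod_lt j b0)).
have -> : delta (Nat.div i b) (Nat.div j b) =
    \sum_(t < d) entry (U 0%N) (Nat.div i b) t * (entry (U 0%N) (Nat.div j b) t)^*.
  have := spectral_mx1 (uU 0%N) => E; rewrite -(entry1 (div_lt hi) (div_lt hj)) -E entry_spectral_mx.
  by apply: eq_bigr => t _; rewrite mul1r.
rewrite !big_distrlr /= -big_split; apply: eq_bigr => x _; rewrite -big_split; apply: eq_bigr => y _ /=.
rewrite /kronF divMDl // modMDl // lnM ?eig_of_nat_gt0 ?tensor_eig_gt0 // rmorphD /= rmorphM /=.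
rewrite {1}/eig_of_nat valK /= -/b; ring.
Qed.

Lemma tensor_sum_add k l L : eqF (Nat.pow d (k + l)) (tensor_sum (k + l) L)
  (fun i j => kronF (Nat.pow d l) (tensor_sum k L) delta i j + kronF (Nat.pow d l) delta (tensor_sum l (fun j => L (k + j)%N)) i j).
Proof.
elim: k L => [|k IH] L.
  move=> i j hi hj; rewrite /kronF /= /delta.
  rewrite (Nat.div_small i) ?(Nat.div_small j) ?(Nat.mod_small i) ?(Nat.mod_small j); try exact/ssrnat.ltP.
  by rewrite eqxx mul0r add0r [RHS]mul1r.
move=> i j hi hj; have l0 := pow_gt0 d0 l; have k0 := pow_gt0 d0 k.
have hi' : (Nat.div i (Nat.pow d l) < Nat.pow d k.+1)%N by apply: div_lt; rewrite -powD.
have hj' : (Nat.div j (Nat.pow d l) < Nat.pow d k.+1)%N by apply: div_lt; rewrite -powD.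
transitivity (kronF (Nat.pow d l) (kronF (Nat.pow d k) (entry (L 0%N)) delta) delta i j +
   (kronF (Nat.pow d l) (kronF (Nat.pow d k) delta (tensor_sum k (fun x => L x.+1))) delta i j +
    kronF (Nat.pow d l) (kronF (Nat.pow d k) delta delta) (tensor_sum l (fun j => L (k.+1 + j)%N)) i j)).
  rewrite -!kronF_assoc // -powD /=; congr (_ + _).
    by rewrite /kronF -(kronF_delta (a := Nat.pow d k) l0) // -powD mod_lt // pow_gt0.
  rewrite [LHS]/kronF (IH (fun x => L x.+1)) ?mod_lt ?pow_gt0 //.
  by rewrite mulrDr.
rewrite addrA; congr (_ + _).
  by rewrite /= [X in X + _]/kronF [X in _ + X]/kronF [RHS]/kronF -mulrDl.
by rewrite [LHS]/kronF (kronF_delta (a := d) k0 hi' hj').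
Qed.

Lemma tensor_sum_tr_add k L L' i j :
  tensor_sum k L i j + tensor_sum k L' j i = tensor_sum k (fun x => L x + (L' x)^T) i j.
Proof.
elim: k L L' i j => [|k IH] L L' i j; first by rewrite /= addr0.
have /= IH' := IH (fun x => L x.+1) (fun x => L' x.+1).
rewrite /= /kronF -IH'.
have fnD (A B : 'M[K]_d) x y : entry (A + B) x y = entry A x y + entry B x y.
  rewrite /entry; case: (@insub _ _ 'I_d x) => [x'|]; last by rewrite addr0.
  by case: (@insub _ _ 'I_d y) => [y'|]; rewrite ?addr0 // mxE.
rewrite fnD entry_tr [delta (Nat.modulo j _) _]/delta [delta (Nat.div j _) _]/delta.
rewrite [_ == Nat.modulo i _]eq_sym [_ == Nat.div i _]eq_sym -/(delta _ _) -/(delta _ _); ring.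
Qed.

(* [<Omega|W] read as a [D] by [D] matrix, so that [X (x) Y] is sent to [Y^T X]. *)
Definition contract D (W : nat -> nat -> K) (u v : nat) : K := \sum_(w < D) W (w * D + w)%N (v * D + u)%N.

Lemma contract_kronF D A B u v : (u < D)%N -> contract D (kronF D A B) u v = \sum_(w < D) A w v * B w u.
Proof.
by move=> uD; apply: eq_bigr => w _; rewrite /kronF !divMDl // !modMDl.
Qed.

Lemma mulDl_lt D x y : (x < D)%N -> (y < D)%N -> (x * D + y < D * D)%N.
Proof.
move=> xD yD; apply: (@leq_trans (x.+1 * D)); first by rewrite mulSnr ltn_add2l.
by rewrite leq_mul2r xD orbT.
Qed.

Lemma contract_eqF D W W' : eqF (D * D) W W' -> eqF D (contract D W) (contract D W').
Proof. by move=> H u v uD vD; apply: eq_bigr => w _; rewrite H // mulDl_lt. Qed.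

(** Each contraction takes the square root of the dimension, leading from [d^(2^m)] down to [d]. *)
Fixpoint contract_iter (m : nat) (W : nat -> nat -> K) : nat -> nat -> K :=
  if m is m'.+1 then contract_iter m' (contract (dd m') W) else W.

Lemma contract_iter_eqF m W W' : eqF (dd m) W W' -> eqF d (contract_iter m W) (contract_iter m W').
Proof.
elim: m W W' => [|m IH] W W'; first by rewrite dd0.
by rewrite ddS => H; apply/IH/contract_eqF.
Qed.

Lemma contract_iter_sum m (I : finType) (c : I -> K) (W : I -> nat -> nat -> K) W0 :
  (forall i j, W0 i j = \sum_p c p * W p i j) ->
  forall i j, contract_iter m W0 i j = \sum_p c p * contract_iter m (W p) i j.
Proof.
elim: m W W0 => [//|m IH] W W0 H /=; apply: IH => u v.
rewrite /contract; under eq_bigr do rewrite H; rewrite exchange_big.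
by apply: eq_bigr => p _; rewrite mulr_sumr.
Qed.

(** The effect of the iterated contraction on an elementary tensor: the second half is transposed
    and multiplied from the left onto the first. [merge_sum] is the first-order counterpart, for
    sums of one-factor terms. *)
Fixpoint merge_prod (m : nat) (A : nat -> 'M[K]_d) : 'M[K]_d :=
  if m is m'.+1 then merge_prod m' (fun j => (A (Nat.pow 2 m' + j)%N)^T *m A j) else A 0%N.

Fixpoint merge_sum (m : nat) (A : nat -> 'M[K]_d) : 'M[K]_d :=
  if m is m'.+1 then merge_sum m' (fun j => A j + (A (Nat.pow 2 m' + j)%N)^T) else A 0%N.

Lemma contract_iter_tensor m A : eqF d (contract_iter m (tensor (Nat.pow 2 m) A)) (entry (merge_prod m A)).
Proof.
elim: m A => [|m IH] A i j hi hj.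
  by rewrite /= /kronF !Nat.div_1_r !Nat.mod_1_r /delta eqxx mulr1.
rewrite /= -IH //; apply: contract_iter_eqF => // u v hu hv.
rewrite pow2S (contract_eqF (D := dd m) (W' := kronF (dd m) (tensor (Nat.pow 2 m) A) (tensor (Nat.pow 2 m) (fun j => A (Nat.pow 2 m + j)%N)))) //.
  rewrite contract_kronF // -(tensor_mul d0) //; apply: eq_bigr => w _.
  by rewrite (tensor_tr _ (fun j => A (Nat.pow 2 m + j)%N)) mulrC.
by rewrite -powD; apply: tensor_add.
Qed.

Lemma contract_iter_tensor_sum m L : eqF d (contract_iter m (tensor_sum (Nat.pow 2 m) L)) (entry (merge_sum m L)).
Proof.
elim: m L => [|m IH] L i j hi hj.
  by rewrite /= /kronF !Nat.div_1_r !Nat.mod_1_r /delta eqxx mulr1 mulr0 addr0.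
rewrite /= -IH //; apply: contract_iter_eqF => // u v hu hv.
set k := Nat.pow 2 m; pose L' j := L (k + j)%N.
rewrite pow2S (contract_eqF (D := dd m) (W' := fun i j => kronF (dd m) (tensor_sum k L) delta i j + kronF (dd m) delta (tensor_sum k L') i j)) //; last first.
  by rewrite -powD; apply: tensor_sum_add.
rewrite -tensor_sum_tr_add /contract big_split -!/(contract _ _ _ _) !contract_kronF //=; congr (_ + _).
  rewrite (bigD1 (Ordinal hu)) //= big1 ?addr0 => [|w wu]; first by rewrite /delta eqxx mulr1.
  by rewrite /delta -[u]/(val (Ordinal hu)) val_eqE (negPf wu) mulr0.
rewrite (bigD1 (Ordinal hv)) //= big1 ?addr0 => [|w wu]; first by rewrite /delta eqxx mul1r.
by rewrite /delta -[v]/(val (Ordinal hv)) val_eqE (negPf wu) mul0r.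
Qed.

(** In one merging step the inner product [A_j B_j^*] cancels first. What remains is the transpose
    of [B^* A] at index [2^m + j], the reversed product, which is 1 because the matrices are
    square. *)
Lemma merge_prod_inv m A B : (forall j, A j *m (B j)^t* = 1%:M) -> merge_prod m A *m (merge_prod m B)^t* = 1%:M.
Proof.
elim: m A B => [|m IH] A B H //=; apply: IH => j.
rewrite trmx_mul map_mxM !mulmxA -[_ *m A j *m _]mulmxA H mulmx1.
rewrite trmxK -[RHS]trmx1 -(mulmx1C (H (Nat.pow 2 m + j)%N)) trmx_mul; congr (_ *m _).
by rewrite map_trmx trmxK.
Qed.

(** The two halves carry opposite conjugations, and for hermitian matrices transposition is
    conjugation. After one merging step both halves carry the sign [beta j], and the induction
    continues with the hermitian sums [H j + H (2^m + j)]. *)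
Lemma merge_sum_conj m L H : (forall j, (H j)^t* = H j) ->
  (forall j, (j < Nat.pow 2 m)%N -> L j = if beta j then map_mx Num.Def.conjC (H j) else H j) ->
  merge_sum m L = \sum_(j < Nat.pow 2 m) H j.
Proof.
elim: m L H => [|m IH] L H hH HL.
  by rewrite big_ord1 /= HL.
rewrite pow2S big_split_ord /= -big_split /=.
apply: (IH _ (fun j => H j + H (Nat.pow 2 m + j)%N)) => j.
  by rewrite linearD /= map_mxD !hH.
move=> jm; rewrite !HL ?pow2S ?ltn_add2l //; last by rewrite (ltn_trans jm) // -[ltnLHS]addn0 ltn_add2l (leq_ltn_trans _ jm).
rewrite addnC beta_add_pow2 //.
have trC (B : 'M[K]_d) : B^t* = B -> B^T = map_mx Num.Def.conjC B.
  move=> h; rewrite -[in LHS]h; apply/matrixP => x y; rewrite !mxE //.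
have trC' (B : 'M[K]_d) : B^t* = B -> (map_mx Num.Def.conjC B)^T = B.
  by move=> h; rewrite -[RHS]h map_trmx.
case: (beta j) => /=.
  by rewrite (trC _ (hH _)) map_mxD.
by congr (_ + _); apply: trC'.
Qed.
End Contraction.

(** * The right-hand side as a double sum over spectral projections *)

Section TraceFormula.
Variable d : nat.
Hypothesis d0 : (0 < d)%N.
Notation dd m := (Nat.pow d (Nat.pow 2 m)).
Variables A1 An : 'M[K]_d.
Hypothesis hAn : An^t* = An.

(* The argument of [T] in the theorem, with the last factor [P_{2^(m-1)}]. *)
Fixpoint argF (m : nat) : nat -> nat -> K :=
  if m is m'.+1 then kronF (dd m'.+1) (argF m') (fun i j => toC (Pm d (Nat.pow 2 m') i j))
  else kronF d (entry A1) (entry (map_mx Num.Def.conjC An)).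

(* The row vector [<Omega|W]. *)
Definition omega_row D (W : nat -> nat -> K) (p : nat) : K := \sum_(w < D) W (w * D + w)%N p.

(* [<Omega|W B W'^*|Omega>] *)
Definition sandwich_form D (W B W' : nat -> nat -> K) : K :=
  \sum_(p < D * D) \sum_(q < D * D) omega_row D W p * B p q * (omega_row D W' q)^*.

Definition omega_coef D (i : nat) : K := (Nat.modulo i D == Nat.div i D)%:R.

Lemma conj_omega_coef D i : (omega_coef D i)^* = omega_coef D i.
Proof. exact: rmorph_nat. Qed.

Lemma toC_Pm m i j : toC (Pm d (Nat.pow 2 m) i j) = omega_coef (dd m) i * omega_coef (dd m) j.
Proof.
rewrite /Pm /omega_coef -natrM mulnb.
have E x y : Nat.eqb x y = (x == y) by apply/Nat.eqb_spec/eqP.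
by rewrite !E; case: (_ && _).
Qed.

Lemma sum_omega_coef D (G : nat -> K) : \sum_(r < D * D) omega_coef D r * G r = \sum_(w < D) G (w * D + w)%N.
Proof.
rewrite (big_ord_mul D D (fun r => omega_coef D r * G r)); apply: eq_bigr => x _.
rewrite (bigD1 x) //= big1 ?addr0 => [|y yx].
  by rewrite /omega_coef divMDl // modMDl // eqxx mul1r.
by rewrite /omega_coef divMDl // modMDl // val_eqE (negPf yx) mul0r.
Qed.

Lemma sandwich_form_split D W B W' : sandwich_form D W B W' =
  \sum_(v < D) \sum_(r < D) \sum_(v' < D) \sum_(r' < D)
    contract D W r v * B (v * D + r)%N (v' * D + r')%N * (contract D W' r' v')^*.
Proof.
rewrite /sandwich_form (big_ord_mul D D (fun p => \sum_(q < D * D) omega_row D W p * B p q * (omega_row D W' q)^*)).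
apply: eq_bigr => v _; apply: eq_bigr => r _.
by rewrite (big_ord_mul D D (fun q => omega_row D W _ * B _ q * (omega_row D W' q)^*)).
Qed.

(** The last factor of the argument is again a rank-one [|Omega><Omega|], so removing it contracts
    [W] and [W'] once and leaves the same form one level lower. At the bottom, [A1] and the
    conjugate of [An] remain, and hermiticity of [An] turns that conjugate into the transpose
    required by the trace. *)
Lemma sandwich_form_contract m W W' : sandwich_form (dd m) W (argF m) W' =
  \tr (tabM d (contract_iter d m.+1 W) *m A1 *m (tabM d (contract_iter d m.+1 W'))^t* *m An).
Proof.
elim: m W W' => [|m IH] W W'; rewrite sandwich_form_split.
  rewrite dd0; change (contract_iter d 1 W) with (contract (dd 0) W); change (contract_iter d 1 W') with (contract (dd 0) W').
  rewrite dd0.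
  transitivity (\sum_(r < d) \sum_(r' < d) \sum_(v' < d) \sum_(v < d)
     contract d W r v * A1 v v' * (contract d W' r' v')^* * An r' r).
    rewrite exchange_big; apply: eq_bigr => r _.
    under eq_bigr do rewrite exchange_big; rewrite exchange_big; apply: eq_bigr => r' _.
    rewrite exchange_big; apply: eq_bigr => v' _; apply: eq_bigr => v _.
    have /matrixP/(_ r' r) := hAn; rewrite !mxE => <-.
    by rewrite /= /kronF !divMDl // !modMDl // entryE entry_map entryE; ring.
  apply: eq_bigr => r _; rewrite [RHS]mxE; apply: eq_bigr => r' _.
  rewrite [X in _ = X * _]mxE mulr_suml; apply: eq_bigr => v' _.
  rewrite [X in _ = X * _ * _]mxE !mulr_suml; apply: eq_bigr => v _.
  by rewrite !mxE.
set D := dd m.+1; rewrite [contract_iter _ _ _]/= -/D -[RHS]IH.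
transitivity (\sum_(v < D) \sum_(v' < D) (\sum_(r < D) omega_coef (dd m) r * contract D W r v) * argF m v v' *
   (\sum_(r < D) omega_coef (dd m) r * contract D W' r v')^*).
  apply: eq_bigr => v _; rewrite exchange_big; apply: eq_bigr => v' _.
  rewrite [X in X * _]mulr_suml mulr_suml; apply: eq_bigr => r _.
  rewrite rmorph_sum mulr_sumr; apply: eq_bigr => r' _.
  rewrite /= /kronF !divMDl // !modMDl // toC_Pm rmorphM /=.
  rewrite conj_omega_coef; ring.
have DD : D = (dd m * dd m)%N by exact: ddS.
rewrite /sandwich_form -DD; apply: eq_bigr => v _; apply: eq_bigr => v' _.
have s V x : \sum_(r < D) omega_coef (dd m) r * contract D V r x = omega_row (dd m) (contract D V) x.
  suff H M : M = (dd m * dd m)%N ->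
      \sum_(r < M) omega_coef (dd m) r * contract D V r x = omega_row (dd m) (contract D V) x by exact: H.
  by move=> ->; rewrite (sum_omega_coef (dd m) (fun r => contract D V r x)).
by rewrite !s.
Qed.

(** The trace against [|Omega><Omega|] is the expectation in [Omega]. Columns [u_p], [u_q] of the
    eigenbasis contribute [logK (a p) (a q)] times the expectation of [u_p u_p^* B u_q u_q^*]. *)
Lemma trace_Pm_logD m (UF : nat -> nat -> K) (a : 'I_(dd m.+1) -> R) (B T : Mat) :
  toM (dd m.+1) T = logD (tabM (dd m.+1) UF) a (toM (dd m.+1) B) ->
  toC (trace (dd m.+1) (mmul (dd m.+1) (Pm d (Nat.pow 2 m)) T)) =
  \sum_p \sum_q (logK (a p) (a q))%:C *
    sandwich_form (dd m) (fun i j => UF i p * (UF j p)^*) (fun i j => toC (B i j)) (fun i j => UF i q * (UF j q)^*).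
Proof.
move=> TE; set N := dd m.+1 in a TE *; set D := dd m.
have ND : N = (D * D)%N by exact: ddS.
pose t i j := toC (T i j).
have tE i j : (i < N)%N -> (j < N)%N -> t i j =
   \sum_(p < N) \sum_(q < N) (logK (a p) (a q))%:C * UF i p * (UF j q)^* *
      \sum_(x < N) \sum_(y < N) (UF x p)^* * toC (B x y) * UF y q.
  move=> hi hj; move/matrixP/(_ (Ordinal hi) (Ordinal hj)): TE; rewrite [LHS]mxE /= -/(t i j) => ->.
  rewrite [LHS]mxE [RHS]exchange_big; apply: eq_bigr => q _.
  rewrite [X in X * _]mxE mulr_suml; apply: eq_bigr => p _.
  rewrite [X in _ * X * _]mxE [X in _ * (_ * X) * _]mxE.
  have -> : \sum_j (((tabM N UF)^t* *m toM N B) p j) * tabM N UF j q =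
     \sum_(x < N) \sum_(y < N) (UF x p)^* * toC (B x y) * UF y q.
    rewrite [RHS]exchange_big; apply: eq_bigr => y _.
    rewrite mxE mulr_suml; apply: eq_bigr => x _.
    by rewrite !mxE.
  by rewrite !mxE; ring.
transitivity (\sum_(w < D) \sum_(w' < D) t (w * D + w)%N (w' * D + w')%N).
  transitivity (\sum_(k < N) omega_coef D k * \sum_(i < N) omega_coef D i * t k i).
    rewrite toM_trace toM_mul /mxtrace; under eq_bigr do rewrite mxE.
    rewrite exchange_big; apply: eq_bigr => k _; rewrite mulr_sumr; apply: eq_bigr => i _.
    by rewrite !mxE toC_Pm -/D mulrA [omega_coef D k * _]mulrC.
  rewrite ND; under eq_bigr do rewrite (sum_omega_coef D (fun i => t _ i)).
  by rewrite (sum_omega_coef D (fun k => \sum_(w < D) t k (w * D + w)%N)).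
transitivity (\sum_(p < N) \sum_(q < N) (logK (a p) (a q))%:C *
   ((\sum_(w < D) UF (w * D + w)%N p) * (\sum_(w < D) UF (w * D + w)%N q)^* *
     \sum_(x < N) \sum_(y < N) (UF x p)^* * toC (B x y) * UF y q)).
  have lt w : (w < D)%N -> (w * D + w < N)%N by move=> wD; rewrite ND mulDl_lt.
  under eq_bigr do under eq_bigr do rewrite tE ?lt //.
  under eq_bigr do rewrite exchange_big; rewrite exchange_big; apply: eq_bigr => p _.
  under eq_bigr do rewrite exchange_big; rewrite exchange_big; apply: eq_bigr => q _.
  set S := \sum_(x < N) _.
  rewrite rmorph_sum big_distrlr /= mulr_suml mulr_sumr; apply: eq_bigr => w _.
  rewrite mulr_suml mulr_sumr; apply: eq_bigr => w' _; ring.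
apply: eq_bigr => p _; apply: eq_bigr => q _; congr (_ * _).
rewrite /sandwich_form -ND mulr_sumr; apply: eq_bigr => x _; rewrite mulr_sumr; apply: eq_bigr => y _.
rewrite /omega_row -!mulr_suml rmorphM /= conjCK; ring.
Qed.
End TraceFormula.

(** * The trace inequality *)

Lemma interpolation (s : seq R) (phi : R -> R) : exists p : {poly R}, {in s, forall x, p.[x] = phi x}.
Proof.
elim: s => [|y s [p IH]]; first by exists 0.
have [ys|ys] := boolP (y \in s).
  by exists p => x; rewrite inE => /orP[/eqP->|]; apply: IH.
pose q : {poly R} := \prod_(z <- s) ('X - z%:P).
have qy : q.[y] != 0 by rewrite -[_ == 0]/(root q y) root_prod_XsubC.
exists (p + ((phi y - p.[y]) / q.[y]) *: q) => x; rewrite inE hornerD hornerZ.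
case/orP => [/eqP->|xs]; first by rewrite divfK // addrC subrK.
have /eqP-> : root q x by rewrite root_prod_XsubC.
by rewrite mulr0 addr0 IH.
Qed.

(** Only finitely many ratios occur, so [phi] may be replaced by an interpolating polynomial, and
    both sides are linear in [phi]. *)
Lemma ratio_functional d (I : finType) (a : I -> R) (X : I -> 'M[K]_d) :
  (forall k : nat, \sum_i \sum_j ((a i / a j) ^+ k)%:C *: (X i *m (X j)^t*) = 1%:M) ->
  forall phi : R -> R, \sum_i \sum_j (phi (a i / a j))%:C *: (X i *m (X j)^t*) = ((phi 1)%:C)%:M.
Proof.
move=> H phi.
(* The node 1 is included because the right-hand side evaluates [phi] there. *)
have [p pE] := interpolation (1 :: [seq a u.1 / a u.2 | u <- enum {: I * I}]) phi.
rewrite -pE ?mem_head //.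
have pij i j : phi (a i / a j) = p.[a i / a j].
  rewrite pE // inE; apply/orP; right; apply/mapP; exists (i, j) => //.
  by rewrite mem_enum.
under eq_bigr do under eq_bigr do rewrite pij horner_coef rmorph_sum scaler_suml.
under eq_bigr do rewrite exchange_big; rewrite exchange_big.
rewrite horner_coef rmorph_sum raddf_sum; apply: eq_bigr => k _ /=.
rewrite expr1n mulr1 -[RHS]scalemx1 -(H k) scaler_sumr; apply: eq_bigr => i _.
rewrite scaler_sumr; apply: eq_bigr => j _.
by rewrite scalerA -rmorphM.
Qed.

Lemma sum_prod (V : nmodType) (A B : finType) (F : A * B -> V) :
  \sum_x F x = \sum_a \sum_b F (a, b).
Proof. by rewrite pair_bigA; apply: eq_bigr; case. Qed.

(** * Rank-one spectral projections *)

Section Projections.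
Variables (d : nat) (U : 'M[K]_d).
Hypothesis uU : U \is unitarymx.

Definition eigproj (r : 'I_d) : 'M[K]_d := spectral_mx U (fun i => (i == r)%:R).

Lemma eigproj_herm r : (eigproj r)^t* = eigproj r. Proof. exact: spectral_mx_herm. Qed.

Lemma eigprojM r r' : eigproj r *m eigproj r' = (r == r')%:R *: eigproj r.
Proof.
rewrite /eigproj spectral_mxM //; have -> : ((r == r')%:R : K) = ((r == r')%:R)%:C by rewrite rmorph_nat.
rewrite spectral_mxZ; apply: eq_spectral_mx => i; rewrite -!natrM !mulnb.
by case: (eqVneq i r) => [->|_]; rewrite ?andbT ?andbF.
Qed.

Lemma sum_eigproj (f : 'I_d -> R) : \sum_r (f r)%:C *: eigproj r = spectral_mx U f.
Proof.
apply/matrixP => i j; rewrite summxE spectral_mxE.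
transitivity (\sum_r \sum_k (f r)%:C * ((k == r)%:R * (U i k * (U j k)^*))).
  apply: eq_bigr => r _; rewrite mxE spectral_mxE mulr_sumr; apply: eq_bigr => k _.
  by rewrite rmorph_nat.
rewrite exchange_big; apply: eq_bigr => k _; rewrite (bigD1 k) //= eqxx mul1r big1 ?addr0 //.
by move=> r /negPf; rewrite eq_sym => ->; rewrite mul0r mulr0.
Qed.

Lemma sum_eigproj1 : \sum_r eigproj r = 1%:M.
Proof. by rewrite -(spectral_mx1 uU) -sum_eigproj; apply: eq_bigr => r _; rewrite scale1r. Qed.
End Projections.

(** The labels used next have the form [c / a]; this inversion formula turns their weighted kernel
    back into the kernel of the denominators. *)
Lemma logK_inv c a b : 0 < c -> 0 < a -> 0 < b ->
  (c / a) * (c / b) * logK (c / a) (c / b) = c * logK a b.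
Proof.
move=> c0 a0 b0; rewrite logKZ ?invr_gt0 //.
have E : logK a b = logK a^-1 b^-1 / (a * b).
  rewrite -logKZ ?invr_gt0 ?mulr_gt0 // logKC; congr logK.
    by rewrite [a * b]mulrC mulfK // lt0r_neq0.
  by rewrite mulfK // lt0r_neq0.
by rewrite E; field; rewrite !lt0r_neq0.
Qed.

Lemma adjM m n p (A : 'M[K]_(m, n)) (B : 'M[K]_(n, p)) : (A *m B)^t* = B^t* *m A^t*.
Proof. by rewrite trmx_mul map_mxM. Qed.

(** The family consists of the products of a spectral projection of the last matrix, an [X i] and a
    spectral projection of the first matrix. Orthogonality of the projections and cyclicity of the
    trace collapse the resulting multiple sums. *)
Lemma trace_exp_le_sandwich d (I : finType) (X : I -> 'M[K]_d) (al : I -> R)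
    (U1 Un V M : 'M[K]_d) (a1 an h : 'I_d -> R) :
  (forall i, 0 < al i) -> (forall i, 0 < a1 i) -> (forall i, 0 < an i) ->
  U1 \is unitarymx -> Un \is unitarymx -> V \is unitarymx ->
  \sum_i X i = 1%:M -> \sum_i (ln (al i))%:C *: X i = M ->
  (forall phi : R -> R,
     \sum_i \sum_j (phi (al i / al j))%:C *: (X i *m (X j)^t*) = ((phi 1)%:C)%:M) ->
  spectral_mx Un (fun i => ln (an i)) + spectral_mx U1 (fun i => ln (a1 i)) - M = spectral_mx V h ->
  \sum_x (exp (h x))%:C <=
  \sum_i \sum_j (logK (al i) (al j))%:C * \tr (X i *m spectral_mx U1 a1 *m (X j)^t* *m spectral_mx Un an).
Proof.
move=> al0 a10 an0 uU1 uUn uV X1 XM XU VE.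
pose J : finType := ('I_d * ('I_d * I))%type.
pose P (x : J) := eigproj Un x.1 *m X x.2.2 *m eigproj U1 x.2.1.
(* The logarithm of this label splits into two terms minus [ln (al i)], matching the sign of [M] in
   the exponent. *)
pose a (x : J) : R := an x.1 * a1 x.2.1 / al x.2.2.
have PP s r i s' r' j : P (s, (r, i)) *m (P (s', (r', j)))^t* =
    (r == r')%:R *: (eigproj Un s *m X i *m eigproj U1 r *m (X j)^t* *m eigproj Un s').
  have assoc (g x e e' x' g' : 'M[K]_d) :
    g *m x *m e *m (e' *m (x' *m g')) = g *m x *m (e *m e') *m x' *m g' by rewrite !mulmxA.
  rewrite /P /= adjM (adjM (eigproj Un s')) !eigproj_herm assoc eigprojM //.
  by rewrite -scalemxAr -!scalemxAl.
have trcyc (g x e x' g' : 'M[K]_d) :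
    \tr (g *m x *m e *m x' *m g') = \tr ((g' *m g) *m (x *m e *m x')).
  by rewrite mxtrace_mulC !mulmxA.
have trcycZ (x e x' g : 'M[K]_d) b c :
    \tr (x *m (b *: e) *m x' *m (c *: g)) = b * c * \tr (g *m (x *m e *m x')).
  by rewrite -!scalemxAr -!scalemxAl !mxtraceZ mxtrace_mulC mulrA [c * b]mulrC.
have sum6 (W : nmodType) (F : J -> J -> W) : \sum_x \sum_y F x y =
    \sum_s \sum_s' \sum_i \sum_j \sum_r \sum_r' F (s, (r, i)) (s', (r', j)).
  rewrite sum_prod; apply: eq_bigr => s _; rewrite exchange_big sum_prod; apply: eq_bigr => s' _.
  rewrite exchange_big sum_prod exchange_big; apply: eq_bigr => i _.
  rewrite [RHS]exchange_big; apply: eq_bigr => r _.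
  by rewrite sum_prod exchange_big.
have := @trace_exp_le_logK_form d J a P V h; move/(_ _ uV _ _ _)=> H.
apply: le_trans (H _ _ _ _) _.
- by move=> x; rewrite divr_gt0 // mulr_gt0.
- rewrite sum_prod -(sum_eigproj1 uUn); apply: eq_bigr => s _.
  rewrite sum_prod -[RHS]mulmx1 -(sum_eigproj1 uU1) mulmx_sumr; apply: eq_bigr => r _.
  by rewrite /P /= -mulmx_suml -mulmx_sumr X1 mulmx1.
- rewrite -VE -XM -!sum_eigproj.
  transitivity (\sum_s \sum_r \sum_i ((ln (an s))%:C *: P (s, (r, i)) + (ln (a1 r))%:C *: P (s, (r, i))
       - (ln (al i))%:C *: P (s, (r, i)))).
    rewrite sum_prod; apply: eq_bigr => s _; rewrite sum_prod; apply: eq_bigr => r _; apply: eq_bigr => i _.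
    by rewrite /a /= lnM ?mulr_gt0 ?invr_gt0 // lnM // lnV // rmorphB rmorphD /= scalerBl scalerDl.
  have split3 (F1 F2 F3 : 'I_d -> 'I_d -> I -> 'M[K]_d) :
     \sum_s \sum_r \sum_i (F1 s r i + F2 s r i - F3 s r i) =
     \sum_s \sum_r \sum_i F1 s r i + \sum_r \sum_s \sum_i F2 s r i - \sum_i \sum_s \sum_r F3 s r i.
    rewrite [X in _ + X - _]exchange_big [X in _ - X]exchange_big -big_split -sumrB.
    apply: eq_bigr => s _; rewrite [X in _ - X]exchange_big -big_split -sumrB.
    by apply: eq_bigr => r _; rewrite -big_split -sumrB.
  rewrite split3; congr (_ + _ - _).
  + apply: eq_bigr => s _; rewrite -[eigproj Un s]mulmx1 -(sum_eigproj1 uU1) mulmx_sumr scaler_sumr.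
    apply: eq_bigr => r _; rewrite -scaler_sumr /P /= -mulmx_suml -mulmx_sumr X1 mulmx1.
    by [].
  + apply: eq_bigr => r _; rewrite -[eigproj U1 r]mul1mx -(sum_eigproj1 uUn) mulmx_suml scaler_sumr.
    apply: eq_bigr => s _; rewrite -scaler_sumr /P /= -mulmx_suml -mulmx_sumr X1 mulmx1.
    by [].
  + apply: eq_bigr => i _; have XE : X i = (\sum_s eigproj Un s) *m X i *m (\sum_r eigproj U1 r).
      by rewrite !sum_eigproj1 // mul1mx mulmx1.
    rewrite [in RHS]XE !mulmx_suml scaler_sumr; apply: eq_bigr => s _.
    rewrite mulmx_sumr scaler_sumr; apply: eq_bigr => r _.
    by [].
- move=> phi.
  transitivity (\sum_s \sum_s' eigproj Un s *m (\sum_i \sum_j (phi ((an s / an s') * (al i / al j)^-1))%:C *: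
      (X i *m (X j)^t*)) *m eigproj Un s').
    rewrite sum6; apply: eq_bigr => s _; apply: eq_bigr => s' _.
    rewrite mulmx_sumr mulmx_suml; apply: eq_bigr => i _.
    rewrite mulmx_sumr mulmx_suml; apply: eq_bigr => j _.
    rewrite -scalemxAr -scalemxAl.
    have -> : X i *m (X j)^t* = X i *m (\sum_r eigproj U1 r) *m (X j)^t* by rewrite sum_eigproj1 // mulmx1.
    rewrite mulmx_sumr mulmx_suml mulmx_sumr mulmx_suml scaler_sumr; apply: eq_bigr => r _.
    rewrite (bigD1 r) //= big1 ?addr0 => [|r' rr']; last first.
      by rewrite PP eq_sym (negPf rr') scale0r scaler0.
    rewrite PP eqxx scale1r !mulmxA; congr ((phi _)%:C *: _).
    by rewrite /a /=; field; rewrite !lt0r_neq0.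
  transitivity (\sum_s \sum_s' (phi (an s / an s'))%:C *: (eigproj Un s *m eigproj Un s')).
    apply: eq_bigr => s _; apply: eq_bigr => s' _.
    (* For fixed [s] and [s'] the label ratio is a function of [al i / al j], inverted because [al]
       stands in the denominator. *)
    rewrite (XU (fun t => phi (an s / an s' * t^-1))) invr1 mulr1.
    by rewrite -mulmxA mul_scalar_mx -scalemxAr.
  rewrite -[RHS]scalemx1 -(sum_eigproj1 uUn) scaler_sumr; apply: eq_bigr => s _.
  rewrite (bigD1 s) //= big1 ?addr0 => [|s' ss'].
    by rewrite divff ?lt0r_neq0 // eigprojM // eqxx scale1r.
  by rewrite eigprojM // eq_sym (negPf ss') scale0r scaler0.
rewrite sum6 le_eqVlt; apply/orP; left; apply/eqP.
transitivity (\sum_s \sum_i \sum_j \sum_r (logK (al i) (al j))%:C *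
   \tr (X i *m ((a1 r)%:C *: eigproj U1 r) *m (X j)^t* *m ((an s)%:C *: eigproj Un s))).
  (* Under the trace the outer projections meet, so only [s' = s] survives; with [r' = r] the two
     labels share the numerator [an s * a1 r]. *)
  apply: eq_bigr => s _; rewrite (bigD1 s) //= [X in _ + X]big1 ?addr0 => [|s' ss']; last first.
    do 4![apply: big1 => ? _]; rewrite PP mxtraceZ trcyc eigprojM //.
    by rewrite (negPf ss') scale0r mul0mx mxtrace0 !mulr0.
  apply: eq_bigr => i _; apply: eq_bigr => j _; apply: eq_bigr => r _.
  rewrite (bigD1 r) //= big1 ?addr0 => [|r' rr']; last first.
    by rewrite PP eq_sym (negPf rr') scale0r mxtrace0 mulr0.
  rewrite PP eqxx scale1r /a /= logK_inv ?mulr_gt0 // trcyc eigprojM // eqxx scale1r trcycZ.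
  by rewrite !rmorphM /=; ring.
rewrite exchange_big; apply: eq_bigr => i _; rewrite exchange_big; apply: eq_bigr => j _.
rewrite -!sum_eigproj mulmx_sumr raddf_sum mulr_sumr; apply: eq_bigr => s _.
by rewrite mulmx_sumr !mulmx_suml raddf_sum mulr_sumr; apply: eq_bigr.
Qed.

Lemma toC_mI i j : toC (mI i j) = delta i j.
Proof. by rewrite /mI /delta; case: (Nat.eqb_spec i j) => [->|/eqP/negPf->]; rewrite ?eqxx. Qed.

Lemma entry_toM N (X : Mat) : eqF N (entry (toM N X)) (fun i j => toC (X i j)).
Proof. by apply/eqF_tabM; rewrite tabM_entry. Qed.

(** * Application to the tensors of the theorem *)

Lemma kronl_tensor d (l : list (nat * Mat)) : (0 < d)%N -> (forall x, List.In x l -> fst x = d) ->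
  fst (kronl l) = Nat.pow d (List.length l) /\
  eqF (Nat.pow d (List.length l)) (fun i j => toC (snd (kronl l) i j))
    (tensor (List.length l) (fun j => toM d (snd (List.nth j l (d, mI))))).
Proof.
move=> d0; elim: l => [|[a A] l IH] H.
  by split => // i j hi hj; rewrite /= toC_mI.
have [|E1 E2] := IH; first by move=> x xl; apply: H; right.
have -> : a = d by apply: (H (a, A)); left.
rewrite /=; case: (kronl l) E1 E2 => b B /= -> E2; split => // i j hi hj.
have b0 := pow_gt0 d0 (List.length l).
by rewrite [RHS]/kronF entry_toM ?div_lt // -E2 ?mod_lt // -toC_mul.
Qed.

(** [kronl] nests to the right, whereas [argF] splits off the last factor; this reconciles the
    two. *)
Lemma kronl_snoc b B (l : list (nat * Mat)) : (0 < b)%N ->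
  fst (kronl (l ++ (b, B) :: nil)%list) = (fst (kronl l) * b)%N /\
  forall i j, (i < fst (kronl l) * b)%N -> (j < fst (kronl l) * b)%N ->
  toC (snd (kronl (l ++ (b, B) :: nil)%list) i j) =
  kronF b (fun i j => toC (snd (kronl l) i j)) (fun i j => toC (B i j)) i j.
Proof.
move=> b0; elim: l => [|[a A] l [IH1 IH2]] /=.
  split; first by rewrite -[Nat.mul b 1]/(b * 1)%N muln1 mul1n.
  move=> i j; rewrite mul1n => hi hj; rewrite /kron toC_mul /kronF !toC_mI.
  rewrite !Nat.div_1_r !Nat.mod_1_r (Nat.div_small i) ?(Nat.div_small j) ?(Nat.mod_small i) ?(Nat.mod_small j); try exact/ssrnat.ltP.
  by rewrite /delta eqxx mulr1 [RHS]mul1r.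
case: (kronl (l ++ (b, B) :: nil)%list) IH1 IH2 => c C /= ->.
case: (kronl l) => e E /= IH2; split; first by rewrite -[Nat.mul a _]/(a * (e * b))%N -[Nat.mul a e]/(a * e)%N mulnA.
move=> i j hi hj; have eb : (0 < e * b)%N.
  by move: hi; rewrite -[Nat.mul a e]/(a * e)%N -mulnA; case: (e * b)%N => //; rewrite muln0.
transitivity (kronF (e * b) (fun i j => toC (A i j)) (kronF b (fun i j => toC (E i j)) (fun i j => toC (B i j))) i j).
  by rewrite /kron toC_mul [RHS]/kronF -IH2 ?mod_lt.
by rewrite kronF_assoc.
Qed.

Lemma argF_herm d (A1 An : 'M[K]_d) m i j : A1^t* = A1 -> An^t* = An ->
  argF A1 An m i j = (argF A1 An m j i)^*.
Proof.
move=> h1 hn.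
have fnh (A : 'M[K]_d) x y : A^t* = A -> (entry A y x)^* = entry A x y.
  by move=> h; rewrite -{2}h entry_map entry_tr.
elim: m i j => [|m IH] i j /=.
  by rewrite /kronF rmorphM /= fnh // !entry_map; congr (_ * _); rewrite /= conjCK fnh.
rewrite /kronF rmorphM /= -IH; congr (_ * _).
by rewrite !toC_Pm rmorphM /= !conj_omega_coef mulrC.
Qed.

Lemma conj_spectral_mx N (U : 'M[K]_N) f : map_mx Num.Def.conjC (spectral_mx U f) = spectral_mx (map_mx Num.Def.conjC U) f.
Proof.
apply/matrixP => i j; rewrite mxE !spectral_mxE rmorph_sum; apply: eq_bigr => k _.
by rewrite !mxE rmorphM rmorphM /= conjC_R.
Qed.

Lemma merge_prod1 d m (B : nat -> 'M[K]_d) : (forall j, B j = 1%:M) -> merge_prod m B = 1%:M.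
Proof.
elim: m B => [|m IH] B H /=; first exact: H.
by apply: IH => j; rewrite !H trmx1 mulmx1.
Qed.

(** * Eigenvalue data of the tensors and assembly of the bound *)

Section Assembly.
Variables (d n : nat) (A : nat -> Mat).
Hypothesis d0 : (0 < d)%N.
Hypothesis n3 : (3 <= n)%coq_nat.
Hypothesis pA : forall k, (1 <= k)%coq_nat /\ (k <= n)%coq_nat -> posdef d (A k).
(** The number of factors [P_{2^j}] in the argument; the outer projection is [P_{2^m}]. *)
Let m := (nprime n).-1.
Notation dd m := (Nat.pow d (Nat.pow 2 m)).

Lemma nprimeE : nprime n = m.+1.
Proof. by rewrite /m prednK //; apply/ssrnat.leP; exact: Nat.le_max_l. Qed.

Lemma rhoE : (n - 2 + rho n)%N = Nat.pow 2 m.+1.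
Proof.
rewrite /rho nprimeE; apply: subnKC; apply/ssrnat.leP; rewrite -nprimeE /nprime.
case: (Nat.le_gt_cases (n - 2) 1) => h.
  by apply: (Nat.le_trans _ _ _ h); apply/ssrnat.leP; exact: (@pow_gt0 2).
apply: Nat.le_trans (proj2 (Nat.log2_up_spec _ h)) _.
by apply: Nat.pow_le_mono_r => //; exact: Nat.le_max_r.
Qed.

Lemma argT_argF : eqF (dd m.+1) (fun i j => toC (argT d n A i j)) (argF (toM d (A 1%N)) (toM d (A n)) m).
Proof.
rewrite /argT; have -> : (nprime n - 1)%coq_nat = m by rewrite nprimeE /= Nat.sub_0_r.
pose l k := ((d, A 1%N) :: (d, mconj (A n)) ::
   List.map (fun j => (Nat.pow d (Nat.mul 2 (Nat.pow 2 j)), Pm d (Nat.pow 2 j))) (List.seq 0 k))%list.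
suff H k : fst (kronl (l k)) = dd k.+1 /\
  eqF (dd k.+1) (fun i j => toC (snd (kronl (l k)) i j)) (argF (toM d (A 1%N)) (toM d (A n)) k).
  exact: (proj2 (H m)).
elim: k => [|k [IH1 IH2]].
  have dE : Nat.mul d 1 = d by exact: Nat.mul_1_r.
  split; first by rewrite ddS dd0 /= dE.
  move=> i j; rewrite ddS dd0 => hi hj; rewrite /= dE /kron toC_mul /kronF entry_toM ?div_lt //.
  congr (_ * _); rewrite -toM_conj entry_toM ?mod_lt // toC_mul toC_mI !Nat.div_1_r !Nat.mod_1_r.
  by rewrite /delta eqxx mulr1.
have lE : l k.+1 = (l k ++ (dd k.+1, Pm d (Nat.pow 2 k)) :: nil)%list.
  by rewrite /l List.seq_S List.map_app.
have [E1 E2] := kronl_snoc (Pm d (Nat.pow 2 k)) (l k) (pow_gt0 d0 (Nat.pow 2 k.+1)).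
rewrite lE E1 IH1 -ddS; split => // i j hi hj.
by rewrite E2 ?IH1 -?ddS //= [RHS]/kronF -IH2 ?div_lt // -ddS.
Qed.

(** Outside the range [1..n] trivial data are supplied, so that unitarity and positivity hold for
    every index. *)
Lemma spectral_data : exists (U : nat -> 'M[K]_d) (a : nat -> 'I_d -> R),
  [/\ forall k, U k \is unitarymx, forall k i, 0 < a k i &
      forall k, (0 < k <= n)%N -> toM d (A k) = spectral_mx (U k) (a k)].
Proof.
have H k : exists Ua : 'M[K]_d * ('I_d -> R), [/\ Ua.1 \is unitarymx, forall i, 0 < Ua.2 i &
    (0 < k <= n)%N -> toM d (A k) = spectral_mx Ua.1 Ua.2].
  have [/andP[k1 kn]|kn] := boolP (0 < k <= n)%N.
    have [|U [a [uU a0 E]]] := posdef_spectral_mx (pA (k := k) _); first by split; exact/ssrnat.leP.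
    by exists (U, a).
  exists (1%:M, fun=> 1); split => //; apply/unitarymxP.
  by rewrite mul1mx trmx1 map_mx1.
pose Ua k := proj1_sig (constructive_indefinite_description _ (H k)).
exists (fun k => (Ua k).1), (fun k => (Ua k).2).
by split=> k; case: (proj2_sig (constructive_indefinite_description _ (H k))).
Qed.

Variables (U : nat -> 'M[K]_d) (a : nat -> 'I_d -> R).
Hypothesis uU : forall k, U k \is unitarymx.
Hypothesis a0 : forall k i, 0 < a k i.
Hypothesis AE : forall k, (0 < k <= n)%N -> toM d (A k) = spectral_mx (U k) (a k).

(** Position [j] of the tensor holds the inverse of [A (j + 2)], or the identity in the [rho n]
    padding positions. [b] lists its eigenvalues, and [W] is the eigenbasis after the Thue-Morse
    conjugation. *)
Let U' (j : nat) : 'M[K]_d := if (j < n - 2)%N then U j.+2 else 1%:M.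
Let b (j : nat) (i : 'I_d) : R := if (j < n - 2)%N then (a j.+2 i)^-1 else 1.
Let W (j : nat) : 'M[K]_d := if beta j then map_mx Num.Def.conjC (U' j) else U' j.
Let T := Nat.pow 2 m.+1.

Lemma W_unitary j : W j \is unitarymx.
Proof.
have uU' : U' j \is unitarymx.
  rewrite /U'; case: ifP => // _; apply/unitarymxP.
  by rewrite mul1mx trmx1 map_mx1.
by rewrite /W; case: ifP => _; [exact: unitary_conj|exact: uU'].
Qed.

Lemma b_gt0 j i : 0 < b j i.
Proof. by rewrite /b; case: ifP => // _; rewrite invr_gt0. Qed.

Lemma spectral_mx_W j f : spectral_mx (W j) f = if beta j then map_mx Num.Def.conjC (spectral_mx (U' j) f) else spectral_mx (U' j) f.
Proof. by rewrite /W; case: ifP => // _; rewrite conj_spectral_mx. Qed.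

Lemma alphaE j : alpha j.+2 = beta j.
Proof. by rewrite /alpha /= Nat.sub_0_r. Qed.

Lemma calA_tensor : eqF (dd m.+1) (fun i j => toC (calA d n A i j)) (tensor T (fun j => spectral_mx (W j) (b j))).
Proof.
rewrite /calA; set l := (_ ++ _)%list.
have lenl : List.length l = T.
  rewrite /T -rhoE /l List.length_app List.length_map List.length_seq List.repeat_length.
  by [].
have [|_ E] := kronl_tensor (l := l) d0.
  move=> x; rewrite /l List.in_app_iff List.in_map_iff => -[[k [<- _]] //|].
  by move=> /(@List.repeat_spec _ _ _ _) ->.
rewrite lenl in E => i j hi hj; rewrite E //; apply: eq_tensor => {hi hj i j} j jT.
rewrite spectral_mx_W; have [jn|jn] := ltnP j (n - 2).
  have jn' : (j < n - 2)%coq_nat by exact/ssrnat.ltP.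
  rewrite /l List.app_nth1; last by rewrite List.length_map List.length_seq.
  pose g k := (d, conjif (alpha k) (minv d (A k))).
  rewrite (List.nth_indep _ (d, mI) (g 0%N)); last by rewrite List.length_map List.length_seq.
  rewrite List.map_nth List.seq_nth // /g [snd _]/= alphaE.
  have jr : (0 < j.+2 <= n)%N by move: jn; rewrite ltn_subRL => /ltnW.
  have mi := minv_spectral_mx (uU j.+2) (a0 j.+2) (AE jr).
  have -> : spectral_mx (U' j) (b j) = spectral_mx (U j.+2) (fun i => (a j.+2 i)^-1).
    by rewrite /U' jn; apply: eq_spectral_mx => i; rewrite /b jn.
  by case: (beta j); rewrite /= ?toM_conj mi.
have E1 : spectral_mx (U' j) (b j) = 1%:M.
  rewrite /U' ltnNge jn /=; transitivity (spectral_mx (1%:M : 'M[K]_d) (fun=> 1)).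
    by apply: eq_spectral_mx => i; rewrite /b ltnNge jn.
  by apply: spectral_mx1; apply/unitarymxP; rewrite mul1mx trmx1 map_mx1.
rewrite E1 map_mx1 /l List.app_nth2; last first.
  by rewrite List.length_map List.length_seq; exact/ssrnat.leP.
by rewrite List.nth_repeat toM_I; case: beta.
Qed.

Let UF := tensor T W.
Let al (p : 'I_(dd m.+1)) : R := tensor_eig T b p.
Let Q (p : 'I_(dd m.+1)) (i j : nat) : K := UF i p * (UF j p)^*.
Let X p : 'M[K]_d := tabM d (contract_iter d m.+1 (Q p)).

(** Contraction is linear, so a weighted sum of the [X p] is the contraction of the corresponding
    function of the tensor. *)
Lemma sum_X (f : R -> R) (G : nat -> nat -> K) (M : 'M[K]_d) :
  (forall i j, (i < dd m.+1)%N -> (j < dd m.+1)%N -> \sum_p (f (al p))%:C * Q p i j = G i j) ->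
  eqF d (contract_iter d m.+1 G) (entry M) -> \sum_p (f (al p))%:C *: X p = M.
Proof.
move=> HG HM; rewrite -[RHS]tabM_entry; transitivity (tabM d (contract_iter d m.+1 G)); last exact/eqF_tabM.
transitivity (tabM d (contract_iter d m.+1 (fun i j => \sum_p (f (al p))%:C * Q p i j))).
  apply/matrixP => i j; rewrite summxE mxE.
  rewrite (contract_iter_sum d m.+1 (c := fun p => (f (al p))%:C) (W := Q) (fun i j => erefl)).
  by apply: eq_bigr => p _; rewrite !mxE.
exact/eqF_tabM/contract_iter_eqF.
Qed.

Lemma sum_X_mul (f : R -> R) : f 1 = 1 -> (forall x y, 0 < x -> 0 < y -> f (x * y) = f x * f y) ->
  \sum_p (f (al p))%:C *: X p = merge_prod m.+1 (fun j => spectral_mx (W j) (fun i => f (b j i))).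
Proof.
move=> f1 fM; apply: sum_X (contract_iter_tensor d0 m.+1 _) => i j hi hj.
exact: (tensor_spectral_mx d0 W f1 fM b_gt0).
Qed.

Lemma sum_X1 : \sum_p X p = 1%:M.
Proof.
transitivity (\sum_p (1 : R)%:C *: X p); first by apply: eq_bigr => p _; rewrite scale1r.
rewrite (sum_X_mul (f := fun=> 1)) //; last by move=> *; rewrite mulr1.
by apply: merge_prod1 => j; apply: spectral_mx1; exact: W_unitary.
Qed.

(** The Thue-Morse signs undo all conjugations in the merged sum. The minus sign comes from the
    inverses, and the padding contributes [ln 1 = 0]. *)
Lemma sum_X_ln : \sum_p (ln (al p))%:C *: X p = - \sum_(j < n - 2) spectral_mx (U j.+2) (fun i => ln (a j.+2 i)).
Proof.
pose L x := spectral_mx (W x) (fun i => ln (b x i)).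
rewrite (@sum_X ln (tensor_sum T L) (merge_sum m.+1 L)); last 2 first.
- by move=> i j hi hj; apply: (tensor_sum_ln d0 W_unitary b_gt0).
- exact: (contract_iter_tensor_sum d0 m.+1 L).
rewrite (merge_sum_conj (H := fun j => spectral_mx (U' j) (fun i => ln (b j i)))); last 2 first.
- by move=> j; exact: spectral_mx_herm.
- by move=> j _; rewrite /L spectral_mx_W.
rewrite -rhoE big_split_ord /= [X in _ + X]big1 ?addr0 => [|j _]; last first.
  rewrite (@eq_spectral_mx _ _ _ (fun=> 0)).
    by apply/matrixP => x y; rewrite spectral_mxE mxE big1 // => k _; rewrite mul0r.
  by move=> i; rewrite /b ltnNge leq_addr /= ln_1.
rewrite -sumrN; apply: eq_bigr => j _; rewrite /U' ltn_ord.
rewrite -scaleN1r (_ : -1 = (-1 : R)%:C); last by rewrite rmorphN.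
by rewrite spectral_mxZ; apply: eq_spectral_mx => i; rewrite /b ltn_ord lnV // mulN1r.
Qed.

(** For a power [k] the double sum factors into the contraction of the [k]-th power of the tensor
    times the adjoint of that of the [-k]-th power, and these two merged products are inverse to
    each other. *)
Lemma sum_X_ratio (phi : R -> R) :
  \sum_p \sum_q (phi (al p / al q))%:C *: (X p *m (X q)^t*) = ((phi 1)%:C)%:M.
Proof.
apply: ratio_functional => k.
transitivity ((\sum_p (al p ^+ k)%:C *: X p) *m (\sum_q (al q ^- k)%:C *: X q)^t*).
  rewrite mulmx_suml; apply: eq_bigr => p _.
  rewrite raddf_sum /= map_mx_sum mulmx_sumr; apply: eq_bigr => q _.
  by rewrite linearZ /= map_mxZ /= conjC_R -scalemxAr -scalemxAl scalerA -rmorphM mulrC exprMn exprVn.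
rewrite (sum_X_mul (f := fun t => t ^+ k)) ?expr1n //; last by move=> *; rewrite exprMn.
rewrite (sum_X_mul (f := fun t => t ^- k)) ?expr1n ?invr1 //; last by move=> *; rewrite exprMn invfM.
apply: merge_prod_inv => j; rewrite spectral_mx_herm spectral_mxM ?W_unitary // -(spectral_mx1 (W_unitary j)).
by apply: eq_spectral_mx => i; rewrite divff // expf_neq0 // lt0r_neq0 // b_gt0.
Qed.

Lemma toM_sum_logs s k : toM d (List.fold_right (fun k M => madd (mlog d (A k)) M) mzero (List.seq s k)) =
  \sum_(j < k) toM d (mlog d (A (s + j)%N)).
Proof.
elim: k s => [|k IH] s /=; first by rewrite big_ord0; apply/matrixP => i j; rewrite !mxE.
rewrite toM_add IH big_ord_recl addn0; congr (_ + _); apply: eq_bigr => j _.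
by rewrite addSnnS.
Qed.

Lemma sum_logsE : toM d (sum_logs d n A) =
  spectral_mx (U n) (fun i => ln (a n i)) + spectral_mx (U 1) (fun i => ln (a 1%N i))
  + \sum_(j < n - 2) spectral_mx (U j.+2) (fun i => ln (a j.+2 i)).
Proof.
have logE k : (0 < k <= n)%N -> toM d (mlog d (A k)) = spectral_mx (U k) (fun i => ln (a k i)).
  by move=> kn; apply: mlog_spectral_mx => //; apply: AE.
rewrite /sum_logs toM_sum_logs.
transitivity (\sum_(j < n) spectral_mx (U j.+1) (fun i => ln (a j.+1 i))).
  by apply: eq_bigr => j _; rewrite logE //= ltn_ord.
have [k nE] : exists k, n = k.+2.
  by move/ssrnat.leP: n3; case: (n) => [|[|k]] // _; exists k.
by rewrite nE subn2 /= big_ord_recl big_ord_recr /= [X in _ + X]addrC addrA [X in X + _]addrC.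
Qed.

(** The left-hand trace is exposed as a sum of real exponentials, which later shows that it is
    real. *)
Lemma trace_exp_bound :
  exists h : 'I_d -> R, toC (trace d (mexp d (sum_logs d n A))) = \sum_x (exp (h x))%:C /\
  \sum_x (exp (h x))%:C <= toC (trace (dd m.+1) (mmul (dd m.+1) (Pm d (Nat.pow 2 m))
     (mT (dd m.+1) (calA d n A) (argT d n A)))).
Proof.
have herm1 (V : 'M[K]_d) f g : (spectral_mx V f + g)^t* = spectral_mx V f + g^t*.
  by rewrite linearD /= map_mxD spectral_mx_herm.
have hL : (toM d (sum_logs d n A))^t* = toM d (sum_logs d n A).
  rewrite sum_logsE -addrA !herm1; congr (_ + (_ + _)).
  rewrite linear_sum /= map_mx_sum; apply: eq_bigr => j _; exact: spectral_mx_herm.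
have [V [h [uV LE]]] := hermitian_spectral_mx hL.
exists h; split.
  rewrite toM_trace (mexp_spectral_mx uV LE) /spectral_mx mxtrace_mulC mulmxA unitary_mulVmx // mul1mx.
  by apply: eq_bigr => x _; rewrite !mxE eqxx.
have uUF : tabM (dd m.+1) UF \is unitarymx.
  apply/unitarymxP/matrixP => i j; rewrite !mxE.
  transitivity (delta i j); last by [].
  rewrite -(tensor_unitary d0 W_unitary (ltn_ord i) (ltn_ord j)).
  by apply: eq_bigr => t _; rewrite !mxE.
have CE : toM (dd m.+1) (calA d n A) = spectral_mx (tabM (dd m.+1) UF) al.
  apply/matrixP => i j; rewrite mxE calA_tensor // spectral_mxE.
  rewrite -(tensor_spectral_mx d0 (F := id) W (a := b)) //; last exact: b_gt0.
  by apply: eq_bigr => t _; rewrite !mxE.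
have h1 k : (0 < k <= n)%N -> (toM d (A k))^t* = toM d (A k).
  by move=> kn; rewrite AE // spectral_mx_herm.
have n3' : (2 < n)%N by exact/ssrnat.leP.
have n1 : (0 < 1 <= n)%N by rewrite /= (leq_trans _ n3').
have nn : (0 < n <= n)%N by rewrite leqnn andbT (leq_trans _ n3').
have hB : Defs.hermitian (dd m.+1) (argT d n A).
  apply/toM_herm/matrixP => i j; rewrite !mxE !argT_argF //; apply: esym.
  by apply: argF_herm; apply: h1.
have al0 p : 0 < al p by apply: tensor_eig_gt0; exact: b_gt0.
rewrite (trace_Pm_logD (mT_spectral_mx uUF al0 CE hB)).
have EE p q : sandwich_form (dd m) (Q p) (fun i j => toC (argT d n A i j)) (Q q) =
    \tr (X p *m spectral_mx (U 1) (a 1%N) *m (X q)^t* *m spectral_mx (U n) (a n)).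
  rewrite -(AE n1) -(AE nn) -(sandwich_form_contract _ (h1 _ nn)).
  apply: eq_bigr => x _; apply: eq_bigr => y _.
  by rewrite argT_argF // ddS.
under [X in _ <= X]eq_bigr do under eq_bigr do rewrite EE.
apply: (trace_exp_le_sandwich al0 (a0 1) (a0 n) (uU 1) (uU n) uV sum_X1 sum_X_ln sum_X_ratio).
by rewrite opprK -sum_logsE.
Qed.
End Assembly.

Lemma trace_exp_sum_log_le d n (A : nat -> Mat) : (3 <= n)%coq_nat ->
  (forall k, (1 <= k)%coq_nat /\ (k <= n)%coq_nat -> posdef d (A k)) ->
  Cle (trace d (mexp d (sum_logs d n A)))
      (trace (Nat.pow d (Nat.pow 2 (nprime n)))
         (mmul (Nat.pow d (Nat.pow 2 (nprime n))) (Pm d (Nat.pow 2 (nprime n - 1)))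
            (mT (Nat.pow d (Nat.pow 2 (nprime n))) (calA d n A) (argT d n A)))).
Proof.
move=> n3 pA; case: (posnP d) => [->|d0].
  (* In dimension zero the large space also has dimension zero, and both traces are empty sums. *)
  have -> : Nat.pow 0 (Nat.pow 2 (nprime n)) = 0%N.
    by apply: Nat.pow_0_l; apply: Nat.pow_nonzero.
  by split=> //; split=> //; apply/RleP; rewrite lexx.
have [U [a [uU a0 AE]]] := spectral_data pA.
have [h [E le]] := trace_exp_bound d0 n3 uU a0 AE.
rewrite nprimeE (_ : (_ - 1)%N = (nprime n).-1); last by rewrite /= subn1.
(* The order on complex numbers includes equality of imaginary parts, so the right-hand side is real
   because the left-hand side is. *)
move: le; rewrite -E lecE => /andP[/eqP im0 leR].
have im1 : complex.Im (toC (trace d (mexp d (sum_logs d n A)))) = 0.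
  by rewrite E raddf_sum big1.
split; first exact: im1.
by split; [exact: etrans im0 im1|apply/RleP].
Qed.

End TraceInequality.

Theorem theorem1 (d n : nat) (A : nat -> Mat) :
  (3 <= n)%nat ->
  (forall k, (1 <= k <= n)%nat -> posdef d (A k)) ->
  Cle (trace d (mexp d (sum_logs d n A)))
      (trace (d ^ (2 ^ nprime n))
         (mmul (d ^ (2 ^ nprime n)) (Pm d (2 ^ (nprime n - 1)))
            (mT (d ^ (2 ^ nprime n)) (calA d n A) (argT d n A)))).
Proof. exact (@trace_exp_sum_log_le d n A). Qed.
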